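(* Suppose that Assumption (A') (stated in the context) holds and let $\{(x^k,z^k,y^k)\}_{k\ge0}$ be a sequence generated by Algorithm 1 or Algorithm 2, which is assumed to be bounded. Suppose that $\mathcal{F}_r$ satisfies the Łojasiewicz property with Łojasiewicz constant $C_L>0$ and Łojasiewicz exponent $\theta\in[0,1)$ (in the sense of the context). With $\mathcal{F}_k:=\mathcal{F}_r(x^k,z^k,y^k,x^{k-1},y^{k-1})$ for $k\ge1$ and $\mathcal{F}_*:=\lim_{k\to+\infty}\mathcal{F}_k$, the following hold: (i) if $\theta=0$, then $\{\mathcal{F}_k\}_{k\ge1}$ converges in finite time; (ii) if $\theta\in(0,1/2]$, then there exist $k_0\ge1$, $\widehat C_0>0$ and $Q\in[0,1)$ such that for every $k\ge k_0$ $$0\le\mathcal{F}_k-\mathcal{F}_*\le\widehat C_0Q^k;$$ (iii) if $\theta\in(1/2,1)$, then there exist $k_0\ge3$ and $\widehat C_1>0$ such that for every $k\ge k_0$ $$0\le\mathcal{F}_k-\mathcal{F}_*\le\widehat C_1(k-1)^{-\frac{1}{2\theta-1}}.$$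
   Context: Setting. All spaces $\mathbb{R}^N$ carry the Euclidean inner product $\langle\cdot,\cdot\rangle$ and norm $\|\cdot\|$; matrices carry the operator norm. $g\colon\mathbb{R}^m\to\mathbb{R}\cup\{+\infty\}$ is proper and lower semicontinuous, $h\colon\mathbb{R}^n\to\mathbb{R}$ is Fréchet differentiable with $L$-Lipschitz continuous gradient, $A\colon\mathbb{R}^n\to\mathbb{R}^m$ is linear with adjoint $A^*$; the optimization problem is $\min_{x\in\mathbb{R}^n}\{g(Ax)+h(x)\}$. For a symmetric matrix $M$ put $\|x\|_M^2:=\langle Mx,x\rangle$; $M\succcurlyeq M'$ means $\|x\|_M^2\ge\|x\|_{M'}^2$ for all $x$; $\mathrm{Id}$ is the identity matrix; $\lambda_{\min}$ denotes the smallest eigenvalue. The augmented Lagrangian is $\mathcal{L}_r(x,z,y)=g(z)+h(x)+\langle y,Ax-z\rangle+\frac r2\|Ax-z\|^2$ on $\mathbb{R}^n\times\mathbb{R}^m\times\mathbb{R}^m$. Subdifferential. For $\Psi\colon\mathbb{R}^N\to\mathbb{R}\cup\{+\infty\}$ proper lower semicontinuous and $x$ with $\Psi(x)<+\infty$, the Fréchet subdifferential is $\widehat\partial\Psi(x)=\{d:\liminf_{y\to x}\frac{\Psi(y)-\Psi(x)-\langle d,y-x\rangle}{\|y-x\|}\ge0\}$, and the limiting subdifferential $\partial\Psi(x)$ is the set of $d$ for which there are $x^k\to x$, $d^k\to d$ with $\Psi(x^k)\to\Psi(x)$ and $d^k\in\widehat\partial\Psi(x^k)$ for all $k$; both are empty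 where $\Psi=+\infty$. $\mathrm{dist}(x,\Omega)=\inf_{y\in\Omega}\|x-y\|$ (with $\inf\emptyset=+\infty$). Algorithms. Let $\{\mathbf{M}_1^k\}_{k\ge0}\subseteq\mathbb{R}^{n\times n}$, $\{\mathbf{M}_2^k\}_{k\ge0}\subseteq\mathbb{R}^{m\times m}$ be sequences of symmetric positive semidefinite matrices, $r>0$, $0<\rho<2$, and $(x^0,z^0,y^0)\in\mathbb{R}^n\times\mathbb{R}^m\times\mathbb{R}^m$. Both algorithms generate, for every $k\ge0$, $$z^{k+1}\in\arg\min_{z\in\mathbb{R}^m}\Big\{g(z)+\langle y^k,Ax^k-z\rangle+\tfrac r2\|Ax^k-z\|^2+\tfrac12\|z-z^k\|_{\mathbf{M}_2^k}^2\Big\},$$ then $x^{k+1}$, then $y^{k+1}:=y^k+\rho r(Ax^{k+1}-z^{k+1})$, where in Algorithm 1 $$x^{k+1}\in\arg\min_{x\in\mathbb{R}^n}\Big\{h(x)+\langle y^k,Ax-z^{k+1}\rangle+\tfrac r2\|Ax-z^{k+1}\|^2+\tfrac12\|x-x^k\|_{\mathbf{M}_1^k}^2\Big\},$$ and in Algorithm 2 $$x^{k+1}\in\arg\min_{x\in\mathbb{R}^n}\Big\{\langle x-x^k,\nabla h(x^k)\rangle+\langle y^k,Ax-z^{k+1}\rangle+\tfrac r2\|Ax-z^{k+1}\|^2+\tfrac12\|x-x^k\|_{\mathbf{M}_1^k}^2\Big\}.$$ Assumption (A'). (i) $g$ and $h$ are bounded from below; (ii) $A$ is surjective, and we set $T_0:=\frac{1}{\lambda_{\min}(AA^*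 )\rho}$ if $0<\rho\le1$, $T_0:=\frac{\rho}{\lambda_{\min}(AA^* )(2-\rho)^2}$ if $1<\rho<2$; (iii) $\mu_1:=\sup_{k\ge0}\|\mathbf{M}_1^k\|<+\infty$ and $\mu_2:=\sup_{k\ge0}\|\mathbf{M}_2^k\|<+\infty$; (iv) $r>0$, $\rho\in(0,2)$ and $\mu_1\ge0$ are such that $r\ge4T_0L>0$ and $2\mathbf{M}_1^k+rA^*A\succcurlyeq\big(L+\frac{C_{\mathbf M}'}{r}\big)\mathrm{Id}$ for all $k\ge0$, where $C_{\mathbf M}':=(10\mu_1^2+8(L+\mu_1)^2)T_0$ for Algorithm 1 and $C_{\mathbf M}':=(8\mu_1^2+10(L+\mu_1)^2)T_0$ for Algorithm 2. Regularized augmented Lagrangian. $\mathcal{F}_r(x,z,y,x',y')=\mathcal{L}_r(x,z,y)+2T_1\|A^*(y-y')\|^2+C_1\|x-x'\|^2$ on $\mathbb{R}^n\times\mathbb{R}^m\times\mathbb{R}^m\times\mathbb{R}^n\times\mathbb{R}^m$, where $T_1:=\frac{1-\rho}{\lambda_{\min}(AA^* )\rho^2r}$ if $0<\rho\le1$, $T_1:=\frac{\rho-1}{\lambda_{\min}(AA^* )(2-\rho)\rho r}$ if $1<\rho<2$, and $C_1:=\frac{4T_0\mu_1^2}{r}$ for Algorithm 1, $C_1:=\frac{4T_0(L+\mu_1)^2}{r}$ for Algorithm 2. In this setting $\{\mathcal{F}_k\}_{k\ge1}$ is convergent; its limit is $\mathcal{F}_*\in\mathbb{R}$. Łojasiewicz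 property. A proper lower semicontinuous $\Psi$ satisfies the Łojasiewicz property if for any critical point $\widehat u$ of $\Psi$ (i.e. $0\in\partial\Psi(\widehat u)$) there exist $C_L>0$, $\theta\in[0,1)$, $\varepsilon>0$ with $|\Psi(u)-\Psi(\widehat u)|^\theta\le C_L\,\mathrm{dist}(0,\partial\Psi(u))$ for all $u$ in the open ball of radius $\varepsilon$ around $\widehat u$ (with the convention $0^0=0$). If $\mathcal{F}_r$ satisfies it, then $\{(x^k,z^k,y^k)\}$ converges to some $(\widehat x,\widehat z,\widehat y)$ and there exist $C_L>0$, $\theta\in[0,1)$, $\varepsilon>0$ with $|\mathcal{F}_r(u)-\mathcal{F}_*|^\theta\le C_L\,\mathrm{dist}(0,\partial\mathcal{F}_r(u))$ for all $u$ in the open ball of radius $\varepsilon$ around $(\widehat x,\widehat z,\widehat y,\widehat x,\widehat y)$; $\mathcal{F}_r$ is then said to satisfy the Łojasiewicz property with Łojasiewicz constant $C_L$ and Łojasiewicz exponent $\theta$. A sequence converges in finite time if it is constant (equal to its limit) from some index on. *)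

(* Defs.v *)
From HB Require Import structures.
From mathcomp Require Import all_boot all_order all_algebra.
From mathcomp Require Import all_classical all_reals all_analysis.

Set Implicit Arguments.
Unset Strict Implicit.
Unset Printing Implicit Defensive.

Import Order.TTheory GRing.Theory Num.Theory.
Import numFieldNormedType.Exports.

Local Open Scope classical_set_scope.
Local Open Scope ring_scope.

(* R^N is 'cV[R]_N. The library norm on matrices is the sup norm: it is only
   used through its topology (which is the Euclidean one); every norm and
   distance that occurs in a formula below is the Euclidean [enorm]. *)
Section Euclidean.
Context {R : realType}.

Definition dot N (u v : 'cV[R]_N) : R := \sum_i u i 0 * v i 0.

Definition enorm N (u : 'cV[R]_N) : R := Num.sqrt (dot u u).

Definition wnorm2 N (M : 'M[R]_N) (u : 'cV[R]_N) : R := dot (M *m u) u.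

Definition mx_succeq N (M M' : 'M[R]_N) : Prop :=
  forall u : 'cV[R]_N, wnorm2 M' u <= wnorm2 M u.

Definition opnorm N (M : 'M[R]_N) : R :=
  sup [set enorm (M *m u) | u in [set u : 'cV[R]_N | enorm u <= 1]].

(* Used for symmetric matrices only, for which the set of (real) eigenvalues is
   finite and, if N > 0, nonempty. *)
Definition lambda_min N (M : 'M[R]_N) : R := inf [set a : R | eigenvalue M a].

Definition gradient N (f : 'cV[R]_N -> R) (u : 'cV[R]_N) : 'cV[R]_N :=
  \col_i 'D_(delta_mx i 0) f u.

Definition argmin d (U : porderType d) (T : Type) (f : T -> U) : set T :=
  [set t | forall s, (f t <= f s)%O].

Definition edist N (u : 'cV[R]_N) (Omega : set 'cV[R]_N) : \bar R :=
  ereal_inf [set (enorm (u - v))%:E | v in Omega].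

End Euclidean.

(* Functions R^N -> R \cup {+oo} are functions Psi : 'cV[R]_N -> \bar R that
   never take the value -oo. *)
Section Subdifferential.
Context {R : realType} {N : nat}.
Implicit Types (Psi : 'cV[R]_N -> \bar R) (u d : 'cV[R]_N).
Local Open Scope ereal_scope.

Definition proper_fun Psi : Prop :=
  (forall u, -oo < Psi u) /\ (exists u, Psi u < +oo).

Definition frechet_subdiff Psi u : set 'cV[R]_N :=
  [set d | Psi u < +oo /\
    0 <= limf_einf (fun v : 'cV[R]_N =>
           (Psi v - Psi u - (dot d (v - u))%:E) * ((enorm (v - u))^-1)%:E) u^'].

Definition limiting_subdiff Psi u : set 'cV[R]_N :=
  [set d | Psi u < +oo /\
    exists (us ds : nat -> 'cV[R]_N),
      [/\ us @ \oo --> u, ds @ \oo --> d, Psi (us k) @[k --> \oo] --> Psi u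
        & forall k, frechet_subdiff Psi (us k) (ds k)]].

(* t `^ theta with the convention 0 `^ 0 = 0 (the library has 0 `^ 0 = 1). *)
Definition lpow (t : \bar R) (theta : R) : \bar R :=
  if t == 0 then 0 else poweR t theta.

(* The Lojasiewicz inequality relative to the value c, on the open ball of
   radius eps around uhat. *)
Definition lojasiewicz_ineq Psi (c : \bar R) uhat (CL theta eps : R) : Prop :=
  forall u, (enorm (u - uhat) < eps)%R ->
    lpow `|Psi u - c| theta <= CL%:E * edist 0%R (limiting_subdiff Psi u).

Definition lojasiewicz_property Psi : Prop :=
  forall uhat, limiting_subdiff Psi uhat 0%R ->
  exists CL theta eps : R,
    [/\ (0 < CL)%R, (0 <= theta < 1)%R, (0 < eps)%R
      & lojasiewicz_ineq Psi (Psi uhat) uhat CL theta eps].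

End Subdifferential.

Variant algorithm := Algorithm1 | Algorithm2.

Section ADMM.
Context {R : realType} {m n : nat}.
Implicit Types (alg : algorithm) (g : 'cV[R]_m -> \bar R) (h : 'cV[R]_n -> R).
Implicit Types (A : 'M[R]_(m, n)) (L r rho mu : R).
Implicit Types (x : nat -> 'cV[R]_n) (z y : nat -> 'cV[R]_m).

Definition z_objective g A r (M2k : 'M[R]_m) (xk : 'cV[R]_n)
    (zk yk w : 'cV[R]_m) : \bar R :=
  (g w + (dot yk (A *m xk - w) + r / 2 * enorm (A *m xk - w) ^+ 2
          + 2^-1 * wnorm2 M2k (w - zk))%R%:E)%E.

Definition x_objective alg h A r (M1k : 'M[R]_n) (xk : 'cV[R]_n)
    (zk1 yk : 'cV[R]_m) (v : 'cV[R]_n) : R :=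
  (match alg with
   | Algorithm1 => h v
   | Algorithm2 => dot (v - xk) (gradient h xk)
   end)
  + dot yk (A *m v - zk1) + r / 2 * enorm (A *m v - zk1) ^+ 2
  + 2^-1 * wnorm2 M1k (v - xk).

Definition generated_by alg g h A r rho (M1 : nat -> 'M[R]_n)
    (M2 : nat -> 'M[R]_m) x z y : Prop :=
  forall k,
    [/\ argmin (z_objective g A r (M2 k) (x k) (z k) (y k)) (z k.+1),
        argmin (x_objective alg h A r (M1 k) (x k) (z k.+1) (y k)) (x k.+1)
      & y k.+1 = y k + (rho * r) *: (A *m x k.+1 - z k.+1)].

Definition sup_opnorm N (M : nat -> 'M[R]_N) : R :=
  sup (range (fun k => opnorm (M k))).

Definition T0 A rho : R :=
  let l := lambda_min (A *m A^T) in
  if rho <= 1 then 1 / (l * rho) else rho / (l * (2 - rho) ^+ 2).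

Definition T1 A r rho : R :=
  let l := lambda_min (A *m A^T) in
  if rho <= 1 then (1 - rho) / (l * rho ^+ 2 * r)
  else (rho - 1) / (l * (2 - rho) * rho * r).

Definition CM' alg A L rho mu : R :=
  match alg with
  | Algorithm1 => (10 * mu ^+ 2 + 8 * (L + mu) ^+ 2) * T0 A rho
  | Algorithm2 => (8 * mu ^+ 2 + 10 * (L + mu) ^+ 2) * T0 A rho
  end.

Definition C1 alg A L r rho mu : R :=
  match alg with
  | Algorithm1 => 4 * T0 A rho * mu ^+ 2 / r
  | Algorithm2 => 4 * T0 A rho * (L + mu) ^+ 2 / r
  end.

Record assumptionA' alg g h A L r rho (M1 : nat -> 'M[R]_n)
    (M2 : nat -> 'M[R]_m) : Prop := {
  A'_g_bounded_below : exists b : R, forall w, (b%:E <= g w)%E;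
  A'_h_bounded_below : exists b : R, forall v, b <= h v;
  A'_surjective : forall w : 'cV[R]_m, exists v : 'cV[R]_n, A *m v = w;
  A'_M1_bounded : has_ubound (range (fun k => opnorm (M1 k)));
  A'_M2_bounded : has_ubound (range (fun k => opnorm (M2 k)));
  A'_r_large : 0 < 4 * T0 A rho * L <= r;
  A'_succeq : forall k,
    mx_succeq (M1 k *+ 2 + r *: (A^T *m A))
              ((L + CM' alg A L rho (sup_opnorm M1) / r)%:M)
}.

Definition aug_lagrangian g h A r (v : 'cV[R]_n) (w p : 'cV[R]_m) : \bar R :=
  (g w + (h v + dot p (A *m v - w) + r / 2 * enorm (A *m v - w) ^+ 2)%R%:E)%E.

Definition reg_aug_lagrangian alg g h A L r rho mu
    (v : 'cV[R]_n) (w p : 'cV[R]_m) (v' : 'cV[R]_n) (p' : 'cV[R]_m) : \bar R :=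
  (aug_lagrangian g h A r v w p
   + (2 * T1 A r rho * enorm (A^T *m (p - p')) ^+ 2
      + C1 alg A L r rho mu * enorm (v - v') ^+ 2)%R%:E)%E.

(* R^n x R^m x R^m x R^n x R^m as the Euclidean space of stacked vectors. *)
Definition stack (v : 'cV[R]_n) (w p : 'cV[R]_m) (v' : 'cV[R]_n)
    (p' : 'cV[R]_m) : 'cV[R]_(n + (m + (m + (n + m)))) :=
  col_mx v (col_mx w (col_mx p (col_mx v' p'))).

Definition on_stack (F : 'cV[R]_n -> 'cV[R]_m -> 'cV[R]_m ->
                         'cV[R]_n -> 'cV[R]_m -> \bar R)
    (u : 'cV[R]_(n + (m + (m + (n + m))))) : \bar R :=
  F (usubmx u) (usubmx (dsubmx u)) (usubmx (dsubmx (dsubmx u)))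
    (usubmx (dsubmx (dsubmx (dsubmx u)))) (dsubmx (dsubmx (dsubmx (dsubmx u)))).

(* For bounded iterates x, z, y of the algorithms and F their regularized
   augmented Lagrangian, the first component implies that the iterates converge;
   convergence is therefore not assumed, and the second component says that the
   inequality holds around the limit. *)
Definition lojasiewicz_with
    (F : 'cV[R]_(n + (m + (m + (n + m)))) -> \bar R) (Fstar : \bar R)
    x z y (CL theta : R) : Prop :=
  lojasiewicz_property F /\
  forall (xhat : 'cV[R]_n) (zhat yhat : 'cV[R]_m),
    x @ \oo --> xhat -> z @ \oo --> zhat -> y @ \oo --> yhat ->
    exists2 eps : R, 0 < eps &
      lojasiewicz_ineq F Fstar (stack xhat zhat yhat xhat yhat) CL theta eps.

End ADMM.

(* Main.v *)
Require Import Defs.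
From HB Require Import structures.
From mathcomp Require Import all_boot all_order all_algebra.
From mathcomp Require Import all_classical all_reals all_analysis.
From mathcomp Require Import ring lra.

Set Implicit Arguments.
Unset Strict Implicit.
Unset Printing Implicit Defensive.

Import Order.TTheory GRing.Theory Num.Theory.
Import numFieldNormedType.Exports.

Local Open Scope classical_set_scope.
Local Open Scope ring_scope.

(** The regularized augmented Lagrangian plays the role of an energy. Write [s k]
    for the length of the joint step in [x] and [y], [F k] for the energy at
    the iterate [k], and [F*] for its limit.

    Sufficient decrease ([merit_decrease]). Minimality in the [z]-step and
    stationarity in the [x]-step make the augmented Lagrangian decrease, up to
    the increase [|dy|^2 / (rho r)] caused by the multiplier update. Stationarity
    also expresses [A^T y] through gradients of [h]: [A^T dy] follows a linear
    recursion with factor [1 - rho] driven by increments of the gradient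
    ([dual_recursion]). As [A A^T >= lambda_min I], this bounds [|dy|^2] by a
    telescoping difference plus squared steps in [x] ([relaxation_le]); the two
    regularizing terms of the energy absorb the former, and the assumption on
    [2 M1 + r A^T A] absorbs the latter. Hence
    [c (s (k+1))^2 <= F k - F (k+1)].

    Small subgradients ([subgrad_frechet], [subgrad_le]). The optimality
    conditions provide a Frechet subgradient of the energy at each iterate, of
    norm at most [C (s (k+1) + s k)].

    Convergence ([iterates_converge]). A cluster point of the bounded iterates
    is critical and has energy [F*] ([cluster_critical]), so the Lojasiewicz
    inequality holds near it. By concavity of [t^(1 - theta)] it turns the
    decrease into a bound of [s (k+2)] by a fraction of the two preceding
    steps plus a telescoping term; the resulting potential traps the iterates
    close to the cluster point ([cluster_trap]).

    Rates. At the limit, the Lojasiewicz inequality with exponent [theta] and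
    the two estimates above combine, for [delta k = F k - F*], into
    [delta (k+2)^(2 theta) <= M (delta k - delta (k+2))] ([gap_recursion]). The
    three regimes of [theta] are the three behaviours of the nonnegative null
    sequences that satisfy this recursion ([finite_rate], [linear_rate],
    [sublinear_rate]). *)

(** * Euclidean inner product, norm and quadratic forms *)

Section EuclideanTheory.
Context {R : realType}.

Section InnerProduct.
Variable N : nat.
Implicit Types (u v w : 'cV[R]_N) (a : R).

Lemma dotC u v : dot u v = dot v u.
Proof. by apply: eq_bigr => i _; rewrite mulrC. Qed.

Lemma dotDl u v w : dot (u + v) w = dot u w + dot v w.
Proof. by rewrite -big_split; apply: eq_bigr => i _; rewrite mxE mulrDl. Qed.

Lemma dotZl a u v : dot (a *: u) v = a * dot u v.
Proof. by rewrite mulr_sumr; apply: eq_bigr => i _; rewrite mxE mulrA. Qed.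

Lemma dotNl u v : dot (- u) v = - dot u v.
Proof. by rewrite -scaleN1r dotZl mulN1r. Qed.

Lemma dotBl u v w : dot (u - v) w = dot u w - dot v w.
Proof. by rewrite dotDl dotNl. Qed.

Lemma dotDr u v w : dot u (v + w) = dot u v + dot u w.
Proof. by rewrite dotC dotDl !(dotC u). Qed.

Lemma dotZr a u v : dot u (a *: v) = a * dot u v.
Proof. by rewrite dotC dotZl dotC. Qed.

Lemma dotNr u v : dot u (- v) = - dot u v.
Proof. by rewrite dotC dotNl dotC. Qed.

Lemma dotBr u v w : dot u (v - w) = dot u v - dot u w.
Proof. by rewrite dotDr dotNr. Qed.

Lemma dot0l u : dot 0 u = 0.
Proof. by rewrite -(scale0r (0 : 'cV[R]_N)) dotZl mul0r. Qed.

Lemma dot_ge0 u : 0 <= dot u u.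
Proof. by apply: sumr_ge0 => i _; rewrite -expr2 sqr_ge0. Qed.

Lemma dot_eq0 u : dot u u = 0 -> u = 0.
Proof.
move=> /eqP; rewrite psumr_eq0 => [/allP u0|i _]; last by rewrite -expr2 sqr_ge0.
apply/matrixP => i j; rewrite (ord1 j) mxE.
by have := u0 i (mem_index_enum i); rewrite /= mulf_eq0 orbb => /eqP.
Qed.

Lemma enorm_ge0 u : 0 <= enorm u.
Proof. exact: sqrtr_ge0. Qed.

Lemma sqr_enorm u : enorm u ^+ 2 = dot u u.
Proof. by rewrite sqr_sqrtr ?dot_ge0. Qed.

Lemma enorm0 : enorm (0 : 'cV[R]_N) = 0.
Proof. by rewrite /enorm dot0l sqrtr0. Qed.

Lemma enorm_eq0 u : enorm u = 0 -> u = 0.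
Proof. by move=> u0; apply: dot_eq0; rewrite -sqr_enorm u0 expr0n. Qed.

Lemma enormN u : enorm (- u) = enorm u.
Proof. by rewrite /enorm dotNl dotNr opprK. Qed.

Lemma enormC u v : enorm (u - v) = enorm (v - u).
Proof. by rewrite -enormN opprB. Qed.

Lemma enormZ a u : enorm (a *: u) = `|a| * enorm u.
Proof.
by rewrite /enorm dotZl dotZr mulrA -expr2 sqrtrM ?sqr_ge0// sqrtr_sqr.
Qed.

Lemma enorm_le u a : 0 <= a -> dot u u <= a ^+ 2 -> enorm u <= a.
Proof.
by move=> a0; rewrite -sqr_enorm ler_pXn2r ?nnegrE ?enorm_ge0.
Qed.

End InnerProduct.

Lemma dot_mulmxl M N (B : 'M[R]_(M, N)) (u : 'cV_N) (v : 'cV_M) :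
  dot (B *m u) v = dot u (B^T *m v).
Proof.
rewrite /dot.
under eq_bigr do rewrite mxE mulr_suml.
rewrite exchange_big /=; apply: eq_bigr => j _.
rewrite mxE mulr_sumr; apply: eq_bigr => i _.
by rewrite mxE mulrA (mulrC (B i j)) -mulrA.
Qed.

(** The quadratic polynomial [t |-> wnorm2 B (t u + v)] is nonnegative, so its
    discriminant is not positive. *)
Lemma psd_cauchy_schwarz N (B : 'M[R]_N) (u v : 'cV_N) :
  B^T = B -> (forall w : 'cV_N, 0 <= wnorm2 B w) ->
  dot (B *m u) v ^+ 2 <= wnorm2 B u * wnorm2 B v.
Proof.
move=> BT B0; rewrite /wnorm2 in B0 *.
have BC : dot (B *m v) u = dot (B *m u) v.
  by rewrite dot_mulmxl BT dotC.
have q t : 0 <= t ^+ 2 * dot (B *m u) u + 2 * t * dot (B *m u) v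
           + dot (B *m v) v.
  have := B0 (t *: u + v).
  rewrite mulmxDr -scalemxAr dotDl !dotDr !dotZl !dotZr BC.
  by congr (_ <= _); ring.
have [u0|u0] := eqVneq (dot (B *m u) u) 0.
  rewrite u0 mul0r; have [->|b0] := eqVneq (dot (B *m u) v) 0.
    by rewrite expr0n.
  have := q (- (dot (B *m v) v + 1) / (2 * dot (B *m u) v)).
  rewrite u0 mulr0 add0r.
  suff -> : 2 * (- (dot (B *m v) v + 1) / (2 * dot (B *m u) v))
    * dot (B *m u) v + dot (B *m v) v = -1 by rewrite ler0N1.
  by field; rewrite b0.
have {}u0 : 0 < dot (B *m u) u by rewrite lt0r u0 B0.
have := q (- dot (B *m u) v / dot (B *m u) u).
set a := dot (B *m u) u in u0 *; set b := dot (B *m u) v.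
set c := dot (B *m v) v => h.
have -> : a * c = b ^+ 2
  + a * ((- b / a) ^+ 2 * a + 2 * (- b / a) * b + c).
  by field; rewrite gt_eqF.
by rewrite lerDl mulr_ge0 // ltW.
Qed.

Section CauchySchwarz.
Variable N : nat.
Implicit Types (u v w : 'cV[R]_N).

Lemma sqr_dot_le u v : dot u v ^+ 2 <= dot u u * dot v v.
Proof.
have := @psd_cauchy_schwarz N 1%:M u v (trmx1 _ _).
by rewrite /wnorm2 !mul1mx; apply=> w; rewrite mul1mx dot_ge0.
Qed.

Lemma normr_dot u v : `|dot u v| <= enorm u * enorm v.
Proof.
rewrite -(@ler_pXn2r _ 2) ?nnegrE ?mulr_ge0 ?enorm_ge0//.
by rewrite real_normK ?num_real// exprMn !sqr_enorm sqr_dot_le.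
Qed.

Lemma dot_le u v : dot u v <= enorm u * enorm v.
Proof. exact: le_trans (ler_norm _) (normr_dot u v). Qed.

Lemma enormD u v : enorm (u + v) <= enorm u + enorm v.
Proof.
apply: enorm_le; first by rewrite addr_ge0 ?enorm_ge0.
rewrite dotDl !dotDr (dotC v u) -!sqr_enorm.
have := dot_le u v; lra.
Qed.

Lemma enormB u v : enorm (u - v) <= enorm u + enorm v.
Proof. by rewrite -(enormN v) enormD. Qed.

Lemma enorm_triangle w u v : enorm (u - v) <= enorm (u - w) + enorm (w - v).
Proof. by rewrite -[u - v](subrKA w) enormD. Qed.

End CauchySchwarz.

Section LinearMaps.
Variables M N : nat.

(** Cauchy-Schwarz on each row; [K] is the Frobenius norm. *)
Lemma mulmx_bounded (B : 'M[R]_(M, N)) :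
  exists2 K, 0 <= K & forall u, enorm (B *m u) <= K * enorm u.
Proof.
pose K := Num.sqrt (\sum_i dot (row i B)^T (row i B)^T).
have K0 : 0 <= \sum_i dot (row i B)^T (row i B)^T.
  by apply: sumr_ge0 => i _; exact: dot_ge0.
exists K; first exact: sqrtr_ge0.
move=> u; apply: enorm_le; first by rewrite mulr_ge0 ?sqrtr_ge0 ?enorm_ge0.
rewrite exprMn sqr_enorm sqr_sqrtr// mulr_suml; apply: ler_sum => i _.
have -> : (B *m u) i 0 = dot (row i B)^T u.
  by rewrite mxE; apply: eq_bigr => j _; rewrite !mxE.
by rewrite -expr2 sqr_dot_le.
Qed.

End LinearMaps.

Lemma opnorm_ub N (B : 'M[R]_N) u : enorm (B *m u) <= opnorm B * enorm u.
Proof.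
have [u0|u0] := eqVneq (enorm u) 0.
  by rewrite u0 (enorm_eq0 u0) mulmx0 enorm0 mulr0.
have up : 0 < enorm u by rewrite lt0r u0 enorm_ge0.
have [K K0 BK] := mulmx_bounded B.
have -> : enorm (B *m u) = enorm (B *m ((enorm u)^-1 *: u)) * enorm u.
  rewrite -scalemxAr enormZ ger0_norm ?invr_ge0 ?enorm_ge0//.
  by rewrite mulrAC mulVf // mul1r.
rewrite ler_pM2r//; apply: ub_le_sup.
  exists K => _ [w /= w1 <-]; rewrite (le_trans (BK w))//.
  by rewrite ler_piMr.
exists ((enorm u)^-1 *: u) => //=.
by rewrite enormZ ger0_norm ?invr_ge0 ?enorm_ge0// mulVf.
Qed.

Lemma wnorm2_scalar N (a : R) (u : 'cV_N) : wnorm2 a%:M u = a * dot u u.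
Proof. by rewrite /wnorm2 mul_scalar_mx dotZl. Qed.

(** An invertible positive semidefinite form is bounded below by a positive
    multiple of the squared norm: apply the Cauchy-Schwarz inequality of the
    form to [u] and [B^-1 u]. *)
Lemma psd_unit_coercive N (B : 'M[R]_N) :
  B^T = B -> (forall w : 'cV_N, 0 <= wnorm2 B w) -> B \in unitmx ->
  exists2 c, 0 < c & forall u : 'cV_N, c * dot u u <= wnorm2 B u.
Proof.
move=> BT B0 Bu; have [K K0 BK] := mulmx_bounded (invmx B).
exists (K + 1)^-1; first by rewrite invr_gt0 ltr_wpDl.
move=> u; rewrite mulrC ler_pdivrMr ?ltr_wpDl//.
have := psd_cauchy_schwarz (invmx B *m u) u BT B0.
rewrite /wnorm2 mulKVmx// => cs.
have h : dot u (invmx B *m u) <= (K + 1) * dot u u.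
  rewrite (le_trans (dot_le _ _))// mulrC.
  rewrite (le_trans (ler_wpM2r (enorm_ge0 u) (BK u)))//.
  by rewrite -mulrA -expr2 sqr_enorm ler_wpM2r ?dot_ge0// lerDl.
have [u0|u0] := eqVneq (dot u u) 0.
  by rewrite u0 mulr_ge0// ?addr_ge0//; exact: B0.
have up : 0 < dot u u by rewrite lt0r u0 dot_ge0.
rewrite -(ler_pM2l up) -expr2 (le_trans cs)//.
rewrite -/(wnorm2 B u) (mulrC (wnorm2 B u)) mulrA (mulrC (dot u u)).
by apply: ler_wpM2r => //; exact: B0.
Qed.

Lemma psd_eigenvalue_ge0 N (S : 'M[R]_N) (a : R) :
  S^T = S -> (forall w : 'cV_N, 0 <= wnorm2 S w) -> eigenvalue S a -> 0 <= a.
Proof.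
move=> ST S0 /eigenvalueP[v vS v0].
have vE : S *m v^T = a *: v^T by rewrite -{1}ST -trmx_mul vS linearZ.
have vp : 0 < dot v^T v^T.
  rewrite lt0r dot_ge0 andbT; apply: contraNneq v0 => /dot_eq0 /(congr1 trmx).
  by rewrite trmxK trmx0 => ->.
by have := S0 v^T; rewrite /wnorm2 vE dotZl pmulr_lge0.
Qed.

(** The largest [a] with [a |u|^2 <= <S u, u>] makes [S - a I] positive
    semidefinite; it cannot be coercive, hence is singular, and [a] is an
    eigenvalue. *)
Lemma lambda_min_le N (S : 'M[R]_N) (u : 'cV_N) :
  S^T = S -> (forall w : 'cV_N, 0 <= wnorm2 S w) ->
  lambda_min S * dot u u <= wnorm2 S u.
Proof.
move=> ST S0.
have [u0|u0] := eqVneq (dot u u) 0; first by rewrite u0 mulr0 S0.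
have up : 0 < dot u u by rewrite lt0r u0 dot_ge0.
pose E := [set a | forall w : 'cV_N, a * dot w w <= wnorm2 S w].
have E0 : E 0 by move=> w; rewrite mul0r.
have Eub (w : 'cV_N) : 0 < dot w w -> ubound E (wnorm2 S w / dot w w).
  by move=> wp a Ea; rewrite ler_pdivlMr.
pose a := sup E.
have Ea : E a.
  move=> w; have [w0|w0] := eqVneq (dot w w) 0; first by rewrite w0 mulr0 S0.
  have wp : 0 < dot w w by rewrite lt0r w0 dot_ge0.
  by rewrite -ler_pdivlMr//; apply: ge_sup; [exists 0|exact: Eub].
have BE (w : 'cV_N) : wnorm2 (S - a%:M) w = wnorm2 S w - a * dot w w.
  by rewrite -wnorm2_scalar /wnorm2 mulmxBl dotBl.
have BT : (S - a%:M)^T = S - a%:M by rewrite linearB /= ST tr_scalar_mx.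
have B0 (w : 'cV_N) : 0 <= wnorm2 (S - a%:M) w by rewrite BE subr_ge0 Ea.
have aeig : eigenvalue S a.
  rewrite /eigenvalue /eigenspace kermx_eq0 row_free_unit; apply/negP => Bu.
  have [c c0 Bc] := psd_unit_coercive BT B0 Bu.
  have : E (a + c) by move=> w; have := Bc w; rewrite BE mulrDl; lra.
  move=> /(ub_le_sup (ex_intro _ _ (Eub u up))); rewrite -/a; lra.
apply: le_trans (Ea u); rewrite ler_wpM2r ?dot_ge0//.
apply: ge_inf => //; exists 0 => b; exact: psd_eigenvalue_ge0.
Qed.

Lemma gram_psd M N (A : 'M[R]_(M, N)) (u : 'cV_M) :
  wnorm2 (A *m A^T) u = dot (A^T *m u) (A^T *m u).
Proof. by rewrite /wnorm2 -mulmxA dot_mulmxl. Qed.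

Lemma lambda_min_gram_le M N (A : 'M[R]_(M, N)) (u : 'cV_M) :
  lambda_min (A *m A^T) * dot u u <= dot (A^T *m u) (A^T *m u).
Proof.
rewrite -gram_psd; apply: lambda_min_le; first by rewrite trmx_mul trmxK.
by move=> w; rewrite gram_psd dot_ge0.
Qed.

Lemma lambda_min_gram_ge0 M N (A : 'M[R]_(M, N)) :
  0 <= lambda_min (A *m A^T).
Proof.
rewrite /lambda_min; set E := [set _ | _].
have [->|/set0P[a Ea]] := eqVneq E set0; first by rewrite inf0.
apply: lb_le_inf; first by exists a.
move=> b; apply: psd_eigenvalue_ge0; first by rewrite trmx_mul trmxK.
by move=> w; rewrite gram_psd dot_ge0.
Qed.

End EuclideanTheory.

(** * Topology through the Euclidean norm *)

Section EuclideanTopology.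
Context {R : realType}.

(** The topology is defined by balls of the sup norm, which is equivalent to the
    Euclidean norm. *)
Lemma nbhs_enormP N (l : 'cV[R]_N) (V : set 'cV[R]_N) :
  nbhs l V <-> exists2 e, 0 < e & forall v, enorm (v - l) < e -> V v.
Proof.
split=> [/nbhs_ballP[e e0 lV]|[e e0 lV]].
  exists e => // v vl; apply: lV; split=> // i j; rewrite (ord1 j).
  rewrite /ball /= distrC; apply: le_lt_trans vl.
  rewrite -(@ler_pXn2r _ 2) ?nnegrE ?enorm_ge0// sqr_enorm.
  rewrite real_normK ?num_real// /dot (bigD1 i)//= !mxE -expr2 lerDl.
  by apply: sumr_ge0 => k _; rewrite -expr2 sqr_ge0.
have N0 : 0 < N.+1%:R :> R by rewrite ltr0n.
apply/nbhs_ballP; exists (e / N.+1%:R) => /=; first by rewrite divr_gt0.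
move=> v [_ lv]; apply: lV.
suff h : dot (v - l) (v - l) <= (e * N%:R / N.+1%:R) ^+ 2.
  apply: le_lt_trans (enorm_le _ h) _; last first.
    by rewrite ltr_pdivrMr// ltr_pM2l// ltr_nat.
  by rewrite divr_ge0 ?mulr_ge0 ?ler0n// ltW.
have -> : (e * N%:R / N.+1%:R) ^+ 2 = (e / N.+1%:R) ^+ 2 * N%:R ^+ 2.
  by rewrite -exprMn; congr (_ ^+ 2); rewrite mulrAC.
apply: le_trans (_ : \sum_(i < N) (e / N.+1%:R) ^+ 2 <= _).
  apply: ler_sum => i _; rewrite -expr2 -real_normK ?num_real//.
  rewrite ler_pXn2r ?nnegrE ?divr_ge0 ?ler0n// ?(ltW e0)// !mxE.
  by apply: ltW; have := lv i 0; rewrite /ball /= distrC.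
rewrite sumr_const card_ord -[leLHS]mulr_natr ler_wpM2l ?sqr_ge0//.
rewrite -natrX ler_nat; case: (N) => // k.
by rewrite expnS leq_pmulr.
Qed.

Lemma cvg_enormP N (u : nat -> 'cV[R]_N) (l : 'cV[R]_N) :
  u @ \oo --> l <->
  forall e, 0 < e -> exists K, forall k, (K <= k)%N -> enorm (u k - l) < e.
Proof.
split=> [ul e e0|ul V /nbhs_enormP[e e0 lV]].
  have /ul[K _ Ku] : nbhs l [set v | enorm (v - l) < e].
    by apply/nbhs_enormP; exists e.
  by exists K.
have [K Ku] := ul e e0.
by exists K => // k /Ku; exact: lV.
Qed.

(** Bolzano-Weierstrass; boxes are compact in the space of rows, hence the
    transpositions. *)
Lemma bounded_has_cluster N (u : nat -> 'cV[R]_N) (B : R) :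
  (forall k, enorm (u k) <= B) ->
  exists l, forall e, 0 < e -> forall K, exists2 k, (K <= k)%N &
    enorm (u k - l) < e.
Proof.
move=> uB.
pose F := (fun k => (u k)^T) @ \oo.
have FB : F [set v : 'rV[R]_N | forall i, (`[- B, B]%classic : set R) (v 0 i)].
  exists 0%N => // k _ i /=; rewrite in_itv /= mxE -ler_norml.
  apply: le_trans (uB k).
  rewrite -(@ler_pXn2r _ 2) ?nnegrE ?enorm_ge0// sqr_enorm.
  rewrite real_normK ?num_real// /dot (bigD1 i)//= -expr2 lerDl.
  by apply: sumr_ge0 => j _; rewrite -expr2 sqr_ge0.
have [l [_ Fl]] := rV_compact (fun=> @segment_compact R (- B) B) _ FB.
exists l^T => e e0 K.
have lV : nbhs l^T [set v | enorm (v - l^T) < e] by apply/nbhs_enormP; exists e.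
move/nbhs_ballP: lV => [d d0 lV].
have Vl : nbhs l (ball l d) by apply/nbhs_ballP; exists d.
have FK : F [set v | exists2 k, (K <= k)%N & v = (u k)^T].
  by exists K => // k /= Kk; exists k.
have [v [[k Kk ->] [_ lk]]] := Fl _ _ FK Vl.
exists k => //; apply: lV; split=> // i j.
by rewrite (ord1 j) mxE; have := lk 0 i; rewrite mxE.
Qed.

End EuclideanTopology.
Section EuclideanLimits.
Context {R : realType}.

Lemma cvg_enorm_harmonic N (u : nat -> 'cV[R]_N) (l : 'cV_N) :
  (forall j, enorm (u j - l) < j.+1%:R^-1) -> u @ \oo --> l.
Proof.
move=> ul; apply/cvg_enormP => e e0.
have [K _ KP] := near_infty_natSinv_lt (PosNum e0).
by exists K => k /KP /= ke; exact: lt_trans (ul k) ke.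
Qed.

Lemma cvg_mulmxl M N (B : 'M[R]_(M, N)) (u : nat -> 'cV_N) (l : 'cV_N) :
  u @ \oo --> l -> (fun k => B *m u k) @ \oo --> B *m l.
Proof.
move=> /cvg_enormP ul; apply/cvg_enormP => e e0.
have [K K0 BK] := mulmx_bounded B.
have K1 : 0 < K + 1 by rewrite ltr_wpDl.
have [k0 k0P] := ul _ (divr_gt0 e0 K1); exists k0 => k /k0P.
rewrite -mulmxBr ltr_pdivlMr// => h; rewrite (le_lt_trans (BK _))//.
have := enorm_ge0 (u k - l); lra.
Qed.

Lemma cvg_dot N (u v : nat -> 'cV[R]_N) (l p : 'cV_N) :
  u @ \oo --> l -> v @ \oo --> p ->
  (fun k => dot (u k) (v k)) @ \oo --> dot l p.
Proof.
move=> ul vp; apply: cvg_big => [|i _]; first exact: add_continuous.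
apply: cvgM.
  exact: (cvg_comp _ _ ul (@coord_continuous R N 1 i 0 l)).
exact: (cvg_comp _ _ vp (@coord_continuous R N 1 i 0 p)).
Qed.

Lemma cvg_sqr_enorm N (u : nat -> 'cV[R]_N) (l : 'cV_N) :
  u @ \oo --> l -> (fun k => enorm (u k) ^+ 2) @ \oo --> enorm l ^+ 2.
Proof.
move=> ul; rewrite sqr_enorm (eq_cvg _ _ (fun k => sqr_enorm (u k))).
exact: cvg_dot.
Qed.

End EuclideanLimits.

(** * Subgradients from quadratic minorants, and the descent lemma *)

Section SmoothAndNonsmooth.
Context {R : realType}.

(** The difference quotient that defines the Frechet subdifferential is at least
    [- K |v - u|]. Every subgradient below is obtained in this way: the nonsmooth
    term is controlled by the minimality of [z k.+1], which costs only quadratic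
    errors. *)
Lemma frechet_of_quadratic_minorant N (Psi : 'cV[R]_N -> \bar R) (u d : 'cV_N) (p K : R) :
  0 <= K -> Psi u = p%:E ->
  (forall v, (p + dot d (v - u) - K * dot (v - u) (v - u))%:E <= Psi v)%E ->
  frechet_subdiff Psi u d.
Proof.
move=> K0 Pu Pv; split; first by rewrite Pu ltry.
apply/lee_addgt0Pr => e e0.
rewrite -leeBlDr // sub0e limf_einfE; apply: le_ereal_sup_tmp.
pose V := [set v : 'cV[R]_N | v != u /\ enorm (v - u) < e / (K + 1)].
exists (ereal_inf ((fun v => (Psi v - Psi u - (dot d (v - u))%:E)
                     * ((enorm (v - u))^-1)%:E)%E @` V)).
  exists V => //; rewrite /dnbhs /within /=; apply/nbhs_enormP.
  exists (e / (K + 1)); first by rewrite divr_gt0 // ltr_wpDl.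
  by move=> v vu vNu; split.
apply: le_ereal_inf_tmp => _ [v [vu ve] <-].
have E0 : 0 < enorm (v - u).
  rewrite lt0r enorm_ge0 andbT; apply: contra vu => /eqP/enorm_eq0/eqP.
  by rewrite subr_eq0.
rewrite Pu.
have := Pv v; case: (Psi v) => [q| |] //=; last first.
  by move=> _; rewrite gt0_mulye ?lte_fin ?invr_gt0// leey.
rewrite lee_fin -!EFinB -EFinM lee_fin => h.
rewrite ler_pdivlMr// mulNr.
have K1 : 0 < K + 1 by rewrite ltr_wpDl.
have : K * dot (v - u) (v - u) <= e * enorm (v - u).
  rewrite -sqr_enorm expr2 mulrA ler_wpM2r ?enorm_ge0//.
  have : enorm (v - u) * (K + 1) < e by rewrite -ltr_pdivlMr.
  nra.
lra.
Qed.

Lemma frechet_limiting N (Psi : 'cV[R]_N -> \bar R) (u d : 'cV_N) :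
  frechet_subdiff Psi u d -> limiting_subdiff Psi u d.
Proof.
move=> [Pu ud]; split => //; exists (fun=> u), (fun=> d).
by split; [exact: cvg_cst|exact: cvg_cst|exact: cvg_cst|].
Qed.

Lemma edist0_le N (Omega : set 'cV[R]_N) (d : 'cV_N) :
  Omega d -> (Defs.edist 0%R Omega <= (enorm d)%:E)%E.
Proof.
move=> Od; apply: ereal_inf_lbound; exists d => //.
by rewrite sub0r enormN.
Qed.

(** Test the inequality on small multiples of [- G]. *)
Lemma stationary_of_quadratic_ge0 N (G : 'cV[R]_N) (K : R) :
  (forall d : 'cV_N, 0 <= dot G d + K * dot d d) -> G = 0.
Proof.
move=> h; apply: dot_eq0; apply/eqP; rewrite eq_le dot_ge0 andbT.
have K1 : 0 < `|K| + 1 by rewrite ltr_wpDl.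
have := h (- (`|K| + 1)^-1 *: G); rewrite !dotZr dotZl => h'.
have {h'} : 0 <= (`|K| + 1) ^+ 2
   * (- (`|K| + 1)^-1 * dot G G + K * (- (`|K| + 1)^-1 * (- (`|K| + 1)^-1 * dot G G))).
  by rewrite mulr_ge0 ?sqr_ge0.
have -> : (`|K| + 1) ^+ 2
   * (- (`|K| + 1)^-1 * dot G G + K * (- (`|K| + 1)^-1 * (- (`|K| + 1)^-1 * dot G G)))
  = (K - `|K| - 1) * dot G G.
  by field; rewrite gt_eqF.
have := ler_norm K; have := dot_ge0 G; nra.
Qed.

Section DescentLemma.
Context {N : nat}.
Implicit Types (f : 'cV[R]_N -> R) (u v d : 'cV[R]_N) (L : R).

Lemma derive_gradient f u d : differentiable f u -> 'D_d f u = dot (gradient f u) d.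
Proof.
move=> fu; rewrite deriveE//.
have dE : d = \sum_i d i 0 *: delta_mx i 0.
  rewrite {1}[d]matrix_sum_delta; apply: eq_bigr => i _.
  by rewrite big_ord1.
rewrite {1}dE linear_sum; apply: eq_bigr => i _.
by rewrite linearZ /= mxE deriveE// mulrC.
Qed.

Lemma gradientN f u : differentiable f u -> gradient (\- f) u = - gradient f u.
Proof.
move=> fu; apply/matrixP => i j; rewrite !mxE.
by rewrite deriveN//; exact: diff_derivable.
Qed.

(** Mean value theorem for [phi], the defect of the inequality along the segment
    from [u] to [v]: its derivative is nonpositive by the Lipschitz bound. *)
Lemma descent_le f L u v :
  (forall w, differentiable f w) ->
  (forall w w', enorm (gradient f w - gradient f w') <= L * enorm (w - w')) ->
  f v - f u - dot (gradient f u) (v - u) <= L / 2 * dot (v - u) (v - u).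
Proof.
move=> df lip; set d := v - u.
pose phi (t : R) := f (u + t *: d) - t * dot (gradient f u) d
                    - L / 2 * dot d d * t ^+ 2.
pose dphi (t : R) := dot (gradient f (u + t *: d)) d - dot (gradient f u) d
                     - L * dot d d * t.
have phid t : is_derive t (1 : R) phi (dphi t).
  have fd : is_derive t (1 : R) (fun s : R => f (u + s *: d))
              (dot (gradient f (u + t *: d)) d).
    have lin : is_diff t (fun s : R => u + s *: d) (fun s : R => s *: d).
      by apply: is_diff_eq; rewrite add0r.
    have fl : is_diff t (f \o (fun s : R => u + s *: d))
                ('d f (u + t *: d) \o (fun s : R => s *: d)).
      by apply: is_diff_comp; exact: differentiableP.
    case: fl => dfl vfl; apply: DeriveDef; first exact: diff_derivable.
    rewrite deriveE// vfl /= scale1r -deriveE//.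
    exact: derive_gradient.
  apply: is_derive_eq.
  by rewrite /dphi /= /GRing.scale /=; field.
have [t] : exists2 c, c \in `]0, 1[%R & phi 1 - phi 0 = dphi c * (1 - 0).
  apply: MVT => //.
  apply: derivable_within_continuous => t _; exact: ex_derive.
rewrite in_itv /= => /andP[t0 t1].
rewrite subr0 mulr1 /phi scale1r scale0r addr0 subrKC => pe.
have : dphi t <= 0.
  rewrite /dphi -dotBl.
  have := dot_le (gradient f (u + t *: d) - gradient f u) d.
  have := lip (u + t *: d) u; rewrite addrAC subrr add0r enormZ gtr0_norm//.
  rewrite -(sqr_enorm d); have := enorm_ge0 d; nra.
rewrite -pe; lra.
Qed.

Lemma descent_ge f L u v :
  (forall w, differentiable f w) ->
  (forall w w', enorm (gradient f w - gradient f w') <= L * enorm (w - w')) ->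
  - (L / 2 * dot (v - u) (v - u)) <= f v - f u - dot (gradient f u) (v - u).
Proof.
move=> df lip.
have := @descent_le (\- f) L u v.
rewrite gradientN// dotNl /=.
suff h : (forall w, differentiable (\- f) w) /\ forall w w',
  enorm (gradient (\- f) w - gradient (\- f) w') <= L * enorm (w - w').
  by move=> /(_ h.1 h.2); lra.
split=> [w|w w']; first exact: differentiableN.
by rewrite !gradientN// -opprD enormN lip.
Qed.

End DescentLemma.
End SmoothAndNonsmooth.

(** * Real sequences: trapping and decay rates *)

Section RealSequences.
Context {R : realType}.
Implicit Types (a b c e t p theta : R).

(** Tangent lines of the exponential at [p ln t], evaluated at [ln t] and [0]
    and averaged with weights [p] and [1 - p]. *)
Lemma powR_le_affine t p : 0 <= t -> 0 < p -> p <= 1 ->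
  t `^ p <= 1 + p * (t - 1).
Proof.
move=> t0 p0 p1; have [->|tn0] := eqVneq t 0.
  by rewrite powR0 ?gt_eqF//; lra.
have tp : 0 < t by rewrite lt0r tn0.
rewrite /powR (negbTE tn0); set l := ln t.
have el : expR l = t by rewrite lnK// posrE.
have h1 := expR_ge1Dx (l - p * l).
have h0 := expR_ge1Dx (0 - p * l).
have c0 := expR_gt0 (p * l).
have e1 : expR (l - p * l) * expR (p * l) = t by rewrite -expRD subrK.
have e0 : expR (0 - p * l) * expR (p * l) = 1 by rewrite -expRD subrK expR0.
have {}h1 : (1 + (l - p * l)) * expR (p * l) <= t.
  by rewrite -e1 ler_wpM2r ?(ltW c0).
have {}h0 : (1 + (0 - p * l)) * expR (p * l) <= 1.
  by rewrite -[leRHS]e0 ler_wpM2r ?(ltW c0).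
nra.
Qed.

(** Concavity of [t `^ (1 - theta)], with the derivative at [a] cleared of its
    negative exponent. *)
Lemma powR_concave_gap a b theta : 0 < a -> 0 <= b -> 0 <= theta < 1 ->
  (1 - theta) * (a - b) <= a `^ theta * (a `^ (1 - theta) - b `^ (1 - theta)).
Proof.
move=> a0 b0 /andP[th0 th1].
have -> : b = a * (b / a) by field; rewrite gt_eqF.
have t0 : 0 <= b / a by rewrite divr_ge0 // ltW.
set t := b / a in t0 *; rewrite powRM ?(ltW a0)//.
have -> : a `^ theta * (a `^ (1 - theta) - a `^ (1 - theta) * t `^ (1 - theta))
        = a * (1 - t `^ (1 - theta)).
  have h : a `^ theta * a `^ (1 - theta) = a.
    rewrite -powRD; last by rewrite (gt_eqF a0) implybT.
    by rewrite subrKC powRr1 // ltW.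
  by rewrite mulrBr mulrA h mulrBr mulr1.
have := @powR_le_affine t (1 - theta) t0; nra.
Qed.

Lemma powR_small theta e : 0 < theta -> 0 < e ->
  exists2 e', 0 < e' & forall a, 0 <= a -> a < e' -> a `^ theta <= e.
Proof.
move=> th0 e0; exists (e `^ (theta^-1)); first exact: powR_gt0.
move=> a a0 ae; rewrite -[leRHS]powRr1 ?(ltW e0)//.
rewrite -(mulVf (lt0r_neq0 th0)) powRrM.
by apply: ge0_ler_powR; rewrite ?nnegrE ?powR_ge0// ltW.
Qed.

Lemma le_of_sqr_le_mul a b c : 0 <= a -> 0 <= b -> 0 <= c ->
  a ^+ 2 <= b * c -> a <= b / 4 + c.
Proof.
move=> a0 b0 c0 h.
rewrite -(@ler_pXn2r _ 2) ?nnegrE ?addr_ge0 ?divr_ge0//.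
have := sqr_ge0 (b / 4 - c); nra.
Qed.

(** One-sided: used for nonnegative sequences only, for which it is convergence
    to 0. *)
Definition tends_to_0 (u : nat -> R) :=
  forall e, 0 < e -> exists K, forall k, (K <= k)%N -> u k < e.

Lemma steps_tend_to_0 (delta s : nat -> R) c k0 : 0 < c ->
  (forall k, (k0 <= k)%N -> 0 <= delta k) -> (forall k, 0 <= s k) ->
  (forall k, (k0 <= k)%N -> c * s k.+1 ^+ 2 <= delta k - delta k.+1) ->
  tends_to_0 delta -> tends_to_0 s.
Proof.
move=> c0 delta0 s0 dec delta_to0 e e0.
have [N NP] : exists N, forall k, (N <= k)%N -> delta k < c * e ^+ 2.
  by apply: delta_to0; rewrite mulr_gt0 // exprn_gt0.
exists (maxn k0 N).+1 => -[//|k]; rewrite ltnS geq_max => /andP[kk kN].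
rewrite -(@ltr_pXn2r _ 2) ?nnegrE ?s0 ?(ltW e0)//.
rewrite -(ltr_pM2l c0) (le_lt_trans (dec _ kk))//.
have := NP _ kN; have := delta0 _ (leq_trans kk (leqnSn _)); lra.
Qed.

Section Trapping.
Variables (delta s d : nat -> R) (theta c C K eps : R) (k0 : nat).
Hypotheses (theta01 : 0 <= theta < 1) (c0 : 0 < c) (C0 : 0 <= C) (K0 : 0 <= K).
Hypotheses (eps0 : 0 < eps).
Hypotheses (delta0 : forall k, (k0 <= k)%N -> 0 <= delta k) (s0 : forall k, 0 <= s k).
Hypothesis decrease : forall k, (k0 <= k)%N ->
  c * s k.+1 ^+ 2 <= delta k - delta k.+1.
Hypothesis move : forall k, (k0 <= k)%N -> d k.+1 <= d k + K * (s k.+1 + s k).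
Hypothesis kl : forall k, (k0 <= k)%N -> d k.+1 < eps -> delta k.+1 != 0 ->
  delta k.+1 `^ theta <= C * (s k.+1 + s k).
Hypothesis delta_to0 : tends_to_0 delta.
Hypothesis d_cluster : forall e, 0 < e -> forall N, exists2 k, (N <= k)%N & d k < e.

(* [V] is chosen so that [step_le] becomes [V k.+1 + s k.+2 / 2 <= V k]; the
   other terms of [W] compensate the displacement of [d]. *)
Let phi k := delta k `^ (1 - theta).
Let B := C / (c * (1 - theta)).
Let V k := B * phi k.+1 + s k.+1 / 2 + s k / 4.
Let W k := d k.+1 + K * s k.+1 + 4 * K * V k.

Let theta1 : 0 < 1 - theta. Proof. by case/andP: theta01; lra. Qed.
Let B0 : 0 <= B. Proof. by rewrite divr_ge0 // mulr_ge0 ?ltW. Qed.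

(** Chain the Lojasiewicz inequality, the decrease and the concavity of [phi] to
    get [s k.+2 ^ 2 <= B (s k.+1 + s k) (phi k.+1 - phi k.+2)], and separate the
    product by the inequality of the means. *)
Lemma step_le k : (k0 <= k)%N -> d k.+1 < eps ->
  s k.+2 <= (s k.+1 + s k) / 4 + B * (phi k.+1 - phi k.+2).
Proof.
move=> kk dk; have kk1 : (k0 <= k.+1)%N by exact: leq_trans kk _.
have kk2 : (k0 <= k.+2)%N by exact: leq_trans kk1 _.
have dec := decrease kk1.
have sq := mulr_ge0 (ltW c0) (sqr_ge0 (s k.+2)).
have le21 : delta k.+2 <= delta k.+1 by lra.
have phi21 : 0 <= phi k.+1 - phi k.+2.
  by rewrite subr_ge0; apply: ge0_ler_powR; rewrite ?nnegrE ?delta0// ltW.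
apply: le_of_sqr_le_mul => //; [exact: addr_ge0|exact: mulr_ge0|].
have cth : 0 < c * (1 - theta) by rewrite mulr_gt0.
rewrite /B mulrCA [C / _]mulrC -mulrA -(ler_pM2l cth) mulVKf ?gt_eqF//.
have [d0|dn0] := eqVneq (delta k.+1) 0.
  have d20 : delta k.+2 = 0 by apply/eqP; rewrite eq_le delta0// -d0 le21.
  rewrite /phi d0 d20 subrr !mulr0.
  by move: (ler_wpM2l (ltW theta1) dec); rewrite d0 d20 subrr; lra.
have dp : 0 < delta k.+1 by rewrite lt0r dn0 delta0.
have := powR_concave_gap dp (delta0 kk2) theta01; rewrite -/(phi _) -/(phi _).
have := ler_wpM2r phi21 (kl kk dk dn0).
have := ler_wpM2l (ltW theta1) dec.
lra.
Qed.

Lemma potential_le k : (k0 <= k)%N -> d k.+1 < eps -> W k.+1 <= W k.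
Proof.
move=> kk dk; have := ler_wpM2l K0 (step_le kk dk).
have := move (leq_trans kk (leqnSn _)).
rewrite /W /V; lra.
Qed.

(** Close to the cluster point the potential [W] dominates the distance [d],
    and it does not increase as long as [d < eps]; once [W] is smaller than
    [eps] the sequence can therefore not leave, and stays as close as [W] is
    small. *)
Lemma cluster_trap : tends_to_0 d.
Proof.
move=> e e0.
have B4 : 0 < 4 * K + 4 * K * B + 1.
  by have := mulr_ge0 K0 B0; move: K0; lra.
pose e1 := Num.min e eps; have e10 : 0 < e1 by rewrite lt_min e0.
pose e2 := e1 / 2 / (4 * K + 4 * K * B + 1).
have e20 : 0 < e2 by rewrite !divr_gt0.
have [e3 e30 e3P] := powR_small theta1 e20.
have [N3 N3P] := delta_to0 e30.
have [N4 N4P] := steps_tend_to_0 c0 delta0 s0 decrease delta_to0 e20.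
pose N := (maxn k0 (maxn N3 N4)).+1.
have ssmall k : (N <= k)%N -> s k <= e2.
  rewrite /N => /ltnW; rewrite !geq_max => /and3P[_ _ k4]; exact/ltW/N4P.
have e120 : 0 < e1 / 2 by rewrite divr_gt0.
have [[|k] // kN dk] := d_cluster e120 N.+1.
have := kN; rewrite ltnS => kN1.
have := kN1; rewrite /N => /ltnW; rewrite !geq_max => /and3P[kk k3 k4].
have Wk : W k < e1.
  have := ssmall _ kN1; have := ssmall _ (leq_trans kN1 (leqnSn _)).
  have kk1 := leq_trans kk (leqnSn _).
  have := e3P _ (delta0 kk1) (N3P _ (leq_trans k3 (leqnSn _))).
  rewrite -/(phi k.+1).
  have : e2 * (4 * K + 4 * K * B + 1) = e1 / 2 by rewrite mulfVK// gt_eqF.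
  rewrite /W /V => e2E ph sk1 sk.
  have h1 : B * phi k.+1 <= B * e2 by rewrite ler_wpM2l.
  have h2 : B * phi k.+1 + s k.+1 / 2 + s k / 4 <= B * e2 + 3 / 4 * e2 by lra.
  have := ler_wpM2l K0 h2; have := ler_wpM2l K0 sk1.
  move: K0; lra.
have dW j : d j.+1 <= W j.
  have V0 : 0 <= V j.
    have := mulr_ge0 B0 (powR_ge0 (delta j.+1) (1 - theta)).
    by rewrite -/(phi _) /V; have := s0 j; have := s0 j.+1; lra.
  have := mulr_ge0 K0 V0; have := mulr_ge0 K0 (s0 j.+1); rewrite /W; lra.
have Wj j : W (k + j)%N < e1.
  elim: j => [|j IH]; first by rewrite addn0.
  rewrite addnS; apply: (le_lt_trans _ IH); apply: potential_le.
    exact: leq_trans kk (leq_addr _ _).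
  rewrite (le_lt_trans (dW _))// (lt_le_trans IH)// /e1 ge_min lexx orbT//.
exists k.+1 => -[//|j]; rewrite ltnS => /subnKC <-.
by rewrite (le_lt_trans (dW _))// (lt_le_trans (Wj _))// /e1 ge_min lexx.
Qed.

End Trapping.

Section Rates.
Variables (delta : nat -> R) (theta M : R) (k0 : nat).
Hypotheses (M0 : 0 < M) (delta0 : forall k, (k0 <= k)%N -> 0 <= delta k).
Hypothesis delta_to0 : tends_to_0 delta.
Hypothesis kl : forall k, (k0 <= k)%N -> delta k.+2 != 0 ->
  (delta k.+2 `^ theta) ^+ 2 <= M * (delta k - delta k.+2).

(** For [theta = 0] a nonzero value forces a decrease of at least [1 / M] over two
    steps, which a null sequence allows only finitely often. *)
Lemma finite_rate : theta = 0 ->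
  exists N, forall k, (N <= k)%N -> delta k = 0.
Proof.
move=> th0; have M10 : 0 < M^-1 by rewrite invr_gt0.
have [N NP] := delta_to0 M10.
exists (maxn k0 N).+2 => -[//|[//|k]]; rewrite !ltnS geq_max => /andP[kk kN].
apply/eqP; apply/negPn/negP => /(kl kk).
rewrite th0 powRr0 expr1n => h.
have := NP _ kN; rewrite -(ltr_pM2l M0) mulfV ?gt_eqF//.
have kk2 : (k0 <= k.+2)%N by rewrite ltnW // ltnW.
have := mulr_ge0 (ltW M0) (delta0 kk2); move: h; lra.
Qed.

Lemma two_step_ind (P : nat -> Prop) N : P N -> P N.+1 ->
  (forall k, (N <= k)%N -> P k -> P k.+2) -> forall k, (N <= k)%N -> P k.
Proof.
move=> P0 P1 PS k /subnKC <-.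
suff : P (N + (k - N))%N /\ P (N + (k - N)).+1 by case.
elim: (k - N)%N => [|j [IH1 IH2]]; first by rewrite addn0.
by rewrite addnS; split => //; apply: PS => //; exact: leq_addr.
Qed.

(** Values at most 1 are dominated by their power [2 theta <= 1], so two steps
    contract by the factor [M / (1 + M)], of which [Q] is the square root. *)
Lemma linear_rate : 0 < theta <= 1 / 2 ->
  exists N C0 Q, [/\ 0 < C0, 0 < Q < 1 &
    forall k, (N <= k)%N -> delta k <= C0 * Q ^+ k].
Proof.
move=> /andP[th0 th12].
have [N1 N1P] := delta_to0 ltr01.
pose N := maxn k0 N1; pose Q := Num.sqrt (M / (1 + M)).
have M1 : 0 < 1 + M by rewrite addr_gt0.
have Q2 : Q ^+ 2 = M / (1 + M) by rewrite sqr_sqrtr // divr_ge0 // ltW.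
have Q0 : 0 < Q by rewrite sqrtr_gt0 divr_gt0.
have Q1 : Q < 1.
  rewrite -(@ltr_pXn2r _ 2) ?nnegrE ?(ltW Q0)// Q2 expr1n ltr_pdivrMr//; lra.
have kN0 k : (N <= k)%N -> 0 <= delta k.
  by move=> Nk; apply: delta0; apply: leq_trans Nk; exact: leq_maxl.
have contr k : (N <= k)%N -> delta k.+2 <= Q ^+ 2 * delta k.
  move=> Nk; rewrite Q2 mulrAC ler_pdivlMr//.
  have [->|dn0] := eqVneq (delta k.+2) 0.
    by rewrite mul0r mulr_ge0 ?(ltW M0)// kN0.
  have Nk2 : (N <= k.+2)%N by rewrite ltnW // ltnW.
  have dp : 0 < delta k.+2 by rewrite lt0r dn0 kN0.
  have d1 : delta k.+2 <= 1.
    by apply/ltW/N1P; apply: leq_trans Nk2; exact: leq_maxr.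
  have : (k0 <= k)%N by apply: leq_trans Nk; exact: leq_maxl.
  move=> /kl /(_ dn0).
  have : delta k.+2 <= (delta k.+2 `^ theta) ^+ 2.
    rewrite -powR_mulrn ?powR_ge0// -powRrM -[leLHS]powRr1 ?(ltW dp)//.
    by apply: ger_powR; [rewrite dp|lra].
  lra.
pose C0 := (delta N + delta N.+1 + 1) / Q ^+ N.+1.
have NN1 : (N <= N.+1)%N by [].
have dN := kN0 _ (leqnn N); have dN1 := kN0 _ NN1.
exists N, C0, Q; split; [|by rewrite Q0|].
  by rewrite divr_gt0 ?exprn_gt0 ?ltr_wpDl ?addr_ge0.
have QN : 0 < Q ^+ N.+1 by exact: exprn_gt0.
apply: two_step_ind => [||k Nk IH].
- rewrite /C0 mulrAC ler_pdivlMr// exprS mulrA ler_wpM2r ?exprn_ge0 ?(ltW Q0)//.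
  nra.
- by rewrite /C0 mulfVK ?gt_eqF//; lra.
- rewrite (le_trans (contr _ Nk))// -(add2n k) exprD mulrCA.
  by rewrite ler_wpM2l ?sqr_ge0.
Qed.

(** First order comparison of a decaying power at two points at distance 2:
    [(t / (t - 2)) ^ b <= expR (4 b / t)], and [expR x <= 1 + x expR x]. *)
Lemma powR_shift_le (b t : R) : 0 < b -> 4 <= t ->
  (t - 2) `^ (- b) <= t `^ (- b) * (1 + 4 * b * expR b / t).
Proof.
move=> b0 t4; have t0 : 0 < t by lra.
have t2 : 0 < t - 2 by lra.
rewrite /powR !gt_eqF//.
have -> : - b * ln (t - 2) = - b * ln t + b * ln (t / (t - 2)).
  by rewrite ln_div ?posrE//; ring.
rewrite expRD ler_wpM2l ?expR_ge0//.
have lnle : ln (t / (t - 2)) <= 4 / t.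
  have y0 : 0 < t / (t - 2) by rewrite divr_gt0.
  have := expR_ge1Dx (ln (t / (t - 2))); rewrite lnK ?posrE//.
  have -> : t / (t - 2) = 1 + 2 / (t - 2) by field; rewrite gt_eqF.
  have : 2 / (t - 2) <= 4 / t.
    rewrite ler_pdivrMr// mulrAC ler_pdivlMr//; lra.
  lra.
set x := b * (4 / t).
have x0 : 0 <= x by rewrite mulr_ge0 ?divr_ge0 ?ltW.
have xb : x <= b by rewrite ler_piMr ?(ltW b0)// ler_pdivrMr//; lra.
apply: le_trans (_ : expR x <= _); first by rewrite ler_expR ler_wpM2l ?(ltW b0).
have -> : 4 * b * expR b / t = x * expR b by rewrite /x; field; rewrite gt_eqF.
apply: le_trans (_ : 1 + x * expR x <= _); last first.
  by rewrite lerD2l ler_wpM2l // ler_expR.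
have := expR_ge1Dx (- x).
have : expR (- x) * expR x = 1 by rewrite -expRD addNr expR0.
have := expR_gt0 x; nra.
Qed.

(** Induction in steps of two: if [delta k.+2] exceeded the bound, the recursion
    would force [delta k] above the bound two steps earlier, because the bound
    decays by a factor [1 + O (1 / k)] only; [B] is large enough for the recursion
    to beat this factor. *)
Lemma sublinear_rate : 1 / 2 < theta < 1 ->
  exists N C1, [/\ (3 <= N)%N, 0 < C1 &
    forall k, (N <= k)%N ->
      delta k <= C1 * (k%:R - 1) `^ (- (1 / (2 * theta - 1)))].
Proof.
move=> /andP[th12 th1].
set a := 2 * theta - 1; have a0 : 0 < a by rewrite /a; lra.
set b := 1 / a; have b0 : 0 < b by rewrite divr_gt0.
pose N := (k0 + 3)%N; pose K := 4 * b * expR b.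
have K0 : 0 < K by apply: mulr_gt0 (expR_gt0 b); apply: mulr_gt0.
have MK0 : 0 < M * K by rewrite mulr_gt0.
have kN0 k : (N <= k)%N -> 0 <= delta k.
  by move=> Nk; apply: delta0; apply: leq_trans Nk; exact: leq_addr.
have dN := kN0 _ (leqnn N); have dN1 := kN0 _ (leqnSn N).
have pos k : (N <= k)%N -> 0 < k%:R - 1 :> R.
  rewrite subr_gt0 ltr1n; apply: leq_trans; by rewrite /N addnS ltnS addnS.
pose D := (N.+1%:R - 1 : R) `^ (- b).
have D0 : 0 < D by rewrite powR_gt0 ?pos.
pose B := (M * K) `^ (a^-1) + (delta N + delta N.+1) / D.
have BK : (M * K) `^ (a^-1) <= B.
  by rewrite lerDl divr_ge0 ?addr_ge0 ?(ltW D0).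
have B0 : 0 < B by apply: lt_le_trans BK; exact: powR_gt0.
have BMK : M * K <= B `^ a.
  rewrite -[leLHS]powRr1 ?(ltW MK0)// -(mulVf (lt0r_neq0 a0)) powRrM.
  by apply: ge0_ler_powR; rewrite ?nnegrE ?powR_ge0 ?(ltW a0) ?(ltW B0).
have BD : delta N + delta N.+1 <= B * D.
  by rewrite -ler_pdivrMr// lerDr powR_ge0.
exists N, B; split => //; first by rewrite /N leq_addl.
apply: two_step_ind => [||k Nk IH].
- apply: le_trans (_ : B * D <= _); first lra.
  rewrite ler_wpM2l ?(ltW B0)// /D !powRN lef_pV2 ?posrE ?powR_gt0 ?pos//.
  apply: ge0_ler_powR; rewrite ?nnegrE ?(ltW b0) ?ltW ?pos//.
  by rewrite ltrD2r ltr_nat.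
- rewrite -/D; lra.
- rewrite leNgt; apply/negP => h.
  set t := k.+2%:R - 1 in h.
  have tE : k%:R - 1 = t - 2 by rewrite /t -addn2 natrD; lra.
  have t4 : 4 <= t.
    have : (3%:R : R) <= k%:R by rewrite ler_nat (leq_trans _ Nk)// leq_addl.
    move: tE; lra.
  have t0 : 0 < t by lra.
  have Dt : 0 < t `^ (- b) by exact: powR_gt0.
  have BDt : 0 < B * t `^ (- b) by rewrite mulr_gt0.
  have dp : 0 < delta k.+2 by exact: lt_trans h.
  have kk : (k0 <= k)%N by apply: leq_trans Nk; exact: leq_addr.
  have := kl kk (lt0r_neq0 dp).
  have : (B * t `^ (- b)) * (B `^ a * t^-1) <= (delta k.+2 `^ theta) ^+ 2.
    rewrite -powR_mulrn ?powR_ge0// -powRrM.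
    have -> : (B * t `^ (- b)) * (B `^ a * t^-1)
            = (B * t `^ (- b)) `^ (theta * 2%:R).
      have -> : theta * 2%:R = 1 + a by rewrite /a; ring.
      rewrite powRM ?(ltW B0) ?(ltW Dt)// -powRrM.
      have -> : - b * (1 + a) = - b + - 1 by rewrite /b; field; rewrite gt_eqF.
      rewrite (@powRD _ B 1 a) ?(gt_eqF B0) ?implybT//.
      rewrite (@powRD _ t (- b) (- 1)) ?(gt_eqF t0) ?implybT//.
      rewrite powRr1 ?(ltW B0)// powR_inv1 ?(ltW t0)//; ring.
    by apply: ge0_ler_powR; rewrite ?nnegrE ?(ltW h) ?(ltW BDt) ?(ltW dp)//; lra.
  move: IH; rewrite tE => IH.
  have := powR_shift_le b0 t4; rewrite -/K => h1 h2 h3.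
  have h4 : delta k <= B * t `^ (- b) * (1 + K / t).
    by rewrite (le_trans IH)// -mulrA ler_wpM2l ?(ltW B0).
  have h5 : B * t `^ (- b) * (M * K / t) <= B * t `^ (- b) * (B `^ a * t^-1).
    by rewrite ler_wpM2l ?(ltW BDt)// ler_wpM2r ?invr_ge0 ?(ltW t0).
  have h6 : M * (delta k - delta k.+2) < M * (B * t `^ (- b) * (K / t)).
    by rewrite ltr_pM2l//; lra.
  have : B * t `^ (- b) * (M * K / t) = M * (B * t `^ (- b) * (K / t)) by ring.
  lra.
Qed.

End Rates.
End RealSequences.

(** * Vectors of the product space *)

Section StackedVectors.
Context {R : realType}.

Lemma dot_col_mx M N (a c : 'cV[R]_M) (b d : 'cV[R]_N) :
  dot (col_mx a b) (col_mx c d) = dot a c + dot b d.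
Proof.
rewrite /dot big_split_ord /=; congr (_ + _); apply: eq_bigr => i _.
  by rewrite !col_mxEu.
by rewrite !col_mxEd.
Qed.

Context {m n : nat}.
Implicit Types (v : 'cV[R]_n) (w p : 'cV[R]_m).

Lemma dot_stack v1 w1 p1 v1' p1' v2 w2 p2 v2' p2' :
  dot (@stack R m n v1 w1 p1 v1' p1') (stack v2 w2 p2 v2' p2')
  = dot v1 v2 + dot w1 w2 + dot p1 p2 + dot v1' v2' + dot p1' p2'.
Proof. by rewrite /stack !dot_col_mx !addrA. Qed.

Lemma stackB v1 w1 p1 v1' p1' v2 w2 p2 v2' p2' :
  @stack R m n v1 w1 p1 v1' p1' - stack v2 w2 p2 v2' p2'
  = stack (v1 - v2) (w1 - w2) (p1 - p2) (v1' - v2') (p1' - p2').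
Proof. by rewrite /stack !opp_col_mx !add_col_mx. Qed.

Lemma stackP (u : 'cV[R]_(n + (m + (m + (n + m))))) :
  exists v w p v' p', u = stack v w p v' p'.
Proof.
exists (usubmx u), (usubmx (dsubmx u)), (usubmx (dsubmx (dsubmx u))),
  (usubmx (dsubmx (dsubmx (dsubmx u)))), (dsubmx (dsubmx (dsubmx (dsubmx u)))).
by rewrite /stack !vsubmxK.
Qed.

Lemma on_stack_stack (F : 'cV[R]_n -> 'cV[R]_m -> 'cV[R]_m ->
    'cV[R]_n -> 'cV[R]_m -> \bar R) v w p v' p' :
  on_stack F (stack v w p v' p') = F v w p v' p'.
Proof. by rewrite /on_stack /stack !(col_mxKu, col_mxKd). Qed.

Lemma enorm_stack_le v w p v' p' :
  enorm (@stack R m n v w p v' p')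
  <= enorm v + enorm w + enorm p + enorm v' + enorm p'.
Proof.
have := (enorm_ge0 v, enorm_ge0 w, enorm_ge0 p, enorm_ge0 v', enorm_ge0 p').
move=> [[[[h1 h2] h3] h4] h5].
apply: enorm_le; first by rewrite !addr_ge0.
rewrite dot_stack -!sqr_enorm.
move: (enorm v) (enorm w) (enorm p) (enorm v') (enorm p') h1 h2 h3 h4 h5.
move=> a b c d e a0 b0 c0 d0 e0.
have sq s t : 0 <= s -> 0 <= t -> s ^+ 2 + t ^+ 2 <= (s + t) ^+ 2 :> R.
  by move=> s0 t0; have := mulr_ge0 s0 t0; nra.
rewrite (le_trans _ (sq _ _ _ e0)) ?addr_ge0// lerD2r.
rewrite (le_trans _ (sq _ _ _ d0)) ?addr_ge0// lerD2r.
rewrite (le_trans _ (sq _ _ _ c0)) ?addr_ge0// lerD2r.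
exact: sq.
Qed.

Lemma dot_stack_parts_le v w p v' p' :
  let u := @stack R m n v w p v' p' in
  [/\ dot v v <= dot u u, dot w w <= dot u u & dot p p <= dot u u].
Proof.
rewrite /= dot_stack; split; have := (dot_ge0 v, dot_ge0 w, dot_ge0 p,
  dot_ge0 v', dot_ge0 p'); move=> [[[[]]]]; lra.
Qed.

End StackedVectors.

(** * Estimates behind the sufficient decrease *)

Section QuadraticForms.
Context {R : realType}.

Lemma wnorm2D N (M : 'M[R]_N) (u v : 'cV_N) : M^T = M ->
  wnorm2 M (u + v) = wnorm2 M u + 2 * dot (M *m u) v + wnorm2 M v.
Proof.
move=> MT; rewrite /wnorm2 mulmxDr dotDl !dotDr.
have -> : dot (M *m v) u = dot (M *m u) v by rewrite dot_mulmxl MT dotC.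
ring.
Qed.

Lemma wnorm2_le N (M : 'M[R]_N) (u : 'cV_N) :
  wnorm2 M u <= opnorm M * dot u u.
Proof.
rewrite /wnorm2 (le_trans (dot_le _ _))// -sqr_enorm expr2 mulrA.
by rewrite ler_wpM2r ?enorm_ge0 ?opnorm_ub.
Qed.

Lemma sqr_enormD N (u v : 'cV[R]_N) :
  enorm (u + v) ^+ 2 = enorm u ^+ 2 + 2 * dot u v + enorm v ^+ 2.
Proof. by rewrite !sqr_enorm dotDl !dotDr (dotC v u); ring. Qed.

Lemma opnorm_le_sup N (M : nat -> 'M[R]_N) :
  has_ubound (range (fun k => opnorm (M k))) ->
  forall k, opnorm (M k) <= sup_opnorm M.
Proof. by move=> ub k; apply: ub_le_sup => //; exists k. Qed.

Lemma opnorm_ge0 N (M : 'M[R]_N) : 0 <= opnorm M.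
Proof.
have [K K0 MK] := mulmx_bounded M.
apply: le_trans (_ : enorm (M *m (0 : 'cV_N)) <= _); first exact: enorm_ge0.
apply: ub_le_sup; last by exists 0 => //=; rewrite enorm0 ler01.
exists K => _ [w /= w1 <-]; rewrite (le_trans (MK w))//.
by rewrite ler_piMr.
Qed.

(** Relaxed update with step [rho]: [a'] is a combination of [a] and [W]
    whose coefficient at [a] has modulus [|1 - rho| < 1]. Convexity of the
    squared norm turns the contraction into a telescoping difference. *)
Lemma relaxation_le N (a a' W : 'cV[R]_N) (rho l r eta : R) :
  0 < rho < 2 -> 0 < l -> 0 < r ->
  a' = (1 - rho) *: a - rho *: W -> l * eta <= dot a' a' ->
  (rho * r)^-1 * eta <=
  (if rho <= 1 then (1 - rho) / (l * rho ^+ 2 * r)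
   else (rho - 1) / (l * (2 - rho) * rho * r)) * (dot a a - dot a' a')
  + (if rho <= 1 then 1 / (l * rho) else rho / (l * (2 - rho) ^+ 2)) / r
    * dot W W.
Proof.
move=> /andP[r0 r2] l0 rr0 a'E leta.
have a'a : dot a' a' = (1 - rho) ^+ 2 * dot a a - 2 * (1 - rho) * rho * dot a W
                       + rho ^+ 2 * dot W W.
  by rewrite a'E dotBl !dotBr !dotZl !dotZr (dotC W a); ring.
case: ifPn => [r1|]; last rewrite -ltNge => r1.
  have conv : dot a' a' <= (1 - rho) * dot a a + rho * dot W W.
    have := dot_ge0 (a + W); rewrite dotDl !dotDr (dotC W a) a'a.
    have : 0 <= (1 - rho) * rho by rewrite mulr_ge0 ?subr_ge0 ?(ltW r0).
    nra.
  have D0 : 0 < l * rho ^+ 2 * r by rewrite !mulr_gt0.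
  rewrite -(ler_pM2l D0).
  have -> : l * rho ^+ 2 * r * ((rho * r)^-1 * eta) = rho * (l * eta).
    by field; rewrite !gt_eqF.
  have -> : l * rho ^+ 2 * r * ((1 - rho) / (l * rho ^+ 2 * r)
      * (dot a a - dot a' a') + 1 / (l * rho) / r * dot W W)
    = (1 - rho) * (dot a a - dot a' a') + rho * dot W W.
    by field; rewrite !gt_eqF.
  have := ler_wpM2l (ltW r0) leta; move: conv; lra.
have r20 : 0 < 2 - rho by lra.
have conv : (2 - rho) * dot a' a'
    <= (2 - rho) * (rho - 1) * dot a a + rho ^+ 2 * dot W W.
  have := dot_ge0 ((2 - rho) *: a - rho *: W).
  rewrite dotBl !dotBr !dotZl !dotZr (dotC W a) a'a => h.
  have h' : 0 <= (rho - 1) * ((2 - rho) * ((2 - rho) * dot a a)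
      - rho * ((2 - rho) * dot a W)
      - ((2 - rho) * (rho * dot a W) - rho * (rho * dot W W))).
    by apply: mulr_ge0; [lra|lra].
  lra.
have D0 : 0 < l * (2 - rho) ^+ 2 * rho * r by rewrite !mulr_gt0 ?exprn_gt0.
rewrite -(ler_pM2l D0).
have -> : l * (2 - rho) ^+ 2 * rho * r * ((rho * r)^-1 * eta)
        = (2 - rho) ^+ 2 * (l * eta).
  by field; rewrite !gt_eqF.
have -> : l * (2 - rho) ^+ 2 * rho * r *
    ((rho - 1) / (l * (2 - rho) * rho * r) * (dot a a - dot a' a')
    + rho / (l * (2 - rho) ^+ 2) / r * dot W W)
  = (rho - 1) * (2 - rho) * (dot a a - dot a' a') + rho ^+ 2 * dot W W.
  by field; rewrite !gt_eqF.
have := ler_wpM2l (sqr_ge0 (2 - rho)) leta; lra.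
Qed.

(** Without [c], the right-hand side exceeds the left-hand side by
    [q^2 a^2 + 2 (p a - q b)^2]. For [q > 0] the first term is the gap; for
    [q = 0] the second one is [2 p^2 a^2], with [p > 0]. *)
Lemma descent_gap (p q : R) : 0 <= p -> 0 <= q -> 0 < p + q ->
  exists2 c, 0 < c & forall a b : R,
    c * a ^+ 2 + 2 * (p * a + q * b) ^+ 2
    <= (q ^+ 2 + 4 * p ^+ 2) * a ^+ 2 + 4 * q ^+ 2 * b ^+ 2.
Proof.
move=> p0 q0 pq; have [qE|qn0] := eqVneq q 0.
  have pp : 0 < p by move: pq; rewrite qE addr0.
  exists (2 * p ^+ 2) => [|a b]; first by rewrite mulr_gt0 ?exprn_gt0.
  rewrite qE; lra.
have qp : 0 < q by rewrite lt0r qn0.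
exists (q ^+ 2) => [|a b]; first by rewrite exprn_gt0.
have := sqr_ge0 (p * a - q * b); nra.
Qed.

End QuadraticForms.

(** * The iteration: constants *)

Section Iteration.
Context {R : realType} {m n : nat}.
Variables (alg : algorithm) (g : 'cV[R]_m -> \bar R) (h : 'cV[R]_n -> R).
Variables (A : 'M[R]_(m, n)) (L r rho : R).
Variables (M1 : nat -> 'M[R]_n) (M2 : nat -> 'M[R]_m).
Variables (x : nat -> 'cV[R]_n) (z y : nat -> 'cV[R]_m).
Hypotheses (g_proper : proper_fun g) (g_lsc : lower_semicontinuous g).
Hypothesis h_diff : forall v : 'cV[R]_n, differentiable h v.
Hypothesis h_lip : forall v v' : 'cV[R]_n,
  enorm (gradient h v - gradient h v') <= L * enorm (v - v').
Hypothesis M1_psd : forall k, (M1 k)^T = M1 k /\ mx_succeq (M1 k) 0.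
Hypothesis M2_psd : forall k, (M2 k)^T = M2 k /\ mx_succeq (M2 k) 0.
Hypotheses (r_gt0 : 0 < r) (rho_itv : 0 < rho < 2).
Hypothesis assm : assumptionA' alg g h A L r rho M1 M2.
Hypothesis gen : generated_by alg g h A r rho M1 M2 x z y.
Hypothesis bounded : exists B : R, forall k,
  [/\ enorm (x k) <= B, enorm (z k) <= B & enorm (y k) <= B].

Let mu := sup_opnorm M1.
Let lam := lambda_min (A *m A^T).

Let rho_gt0 : 0 < rho. Proof. by case/andP: rho_itv. Qed.

Lemma mu_ge0 : 0 <= mu.
Proof.
apply: le_trans (opnorm_ge0 (M1 0)) _; apply: opnorm_le_sup.
by case: assm.
Qed.

(** Since [1 / 0 = 0], the condition [0 < 4 T0 L] forces [lambda_min (A A^T)] to be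
    nonzero. *)
Lemma constants_gt0 : [/\ 0 < lam, 0 < T0 A rho & 0 < L].
Proof.
have T0L : 0 < 4 * T0 A rho * L by case: assm => _ _ _ _ _ /andP[].
have l0 : 0 <= lam := lambda_min_gram_ge0 A.
have T00 : 0 <= T0 A rho.
  have r2 : 0 <= 2 - rho by case/andP: rho_itv; lra.
  by rewrite /T0 -/lam; case: ifP => _;
    rewrite divr_ge0 ?mulr_ge0 ?(ltW rho_gt0).
have T0p : 0 < T0 A rho.
  rewrite lt0r T00 andbT; apply: contraTneq T0L => ->.
  by rewrite mulr0 mul0r ltxx.
split => //; last by move: T0L; rewrite pmulr_rgt0 // mulr_gt0.
rewrite lt0r l0 andbT; apply: contraTneq T0p => l00.
rewrite /T0 -/lam l00 !mul0r invr0 !mulr0; case: ifP; by rewrite ltxx.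
Qed.

Let lam_gt0 : 0 < lam. Proof. by case: constants_gt0. Qed.
Let T0_gt0 : 0 < T0 A rho. Proof. by case: constants_gt0. Qed.
Let L_gt0 : 0 < L. Proof. by case: constants_gt0. Qed.

Lemma T1_ge0 : 0 <= T1 A r rho.
Proof.
have [r0 r2] := andP rho_itv.
rewrite /T1 -/lam; case: ifPn => [r1|]; last rewrite -ltNge => r1.
  by rewrite divr_ge0 ?subr_ge0// !mulr_ge0// ltW.
by rewrite divr_ge0 ?subr_ge0 ?(ltW r1)// !mulr_ge0 ?subr_ge0// ltW.
Qed.

(** Lipschitz moduli of the residual [residual k] below with respect to the
    current and to the preceding increment of [x]; the two algorithms evaluate
    the gradient at opposite ends of the increment. *)
Definition modulus_new :=
  match alg with Algorithm1 => L + mu | Algorithm2 => mu end.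
Definition modulus_old :=
  match alg with Algorithm1 => mu | Algorithm2 => L + mu end.

Lemma CM'E : CM' alg A L rho mu =
  (10 * modulus_old ^+ 2 + 8 * modulus_new ^+ 2) * T0 A rho.
Proof. by rewrite /CM' /modulus_old /modulus_new; case: alg => //; ring. Qed.

Lemma C1E : C1 alg A L r rho mu = 4 * T0 A rho * modulus_old ^+ 2 / r.
Proof. by rewrite /C1 /modulus_old; case: alg. Qed.

Lemma moduli_ge0 :
  [/\ 0 <= modulus_new, 0 <= modulus_old & 0 < modulus_new + modulus_old].
Proof.
have := mu_ge0; rewrite /modulus_new /modulus_old => mu0.
by case: alg; split; move: L_gt0; lra.
Qed.

Lemma C1_ge0 : 0 <= C1 alg A L r rho mu.
Proof.
rewrite C1E divr_ge0 ?(ltW r_gt0)//.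
by apply: mulr_ge0 (sqr_ge0 _); rewrite pmulr_rge0// ltW.
Qed.

(** * Optimality conditions of the two subproblems *)

Definition xgrad k : 'cV[R]_n :=
  match alg with
  | Algorithm1 => gradient h (x k.+1)
  | Algorithm2 => gradient h (x k)
  end.

Definition residual k : 'cV[R]_n := xgrad k + M1 k *m (x k.+1 - x k).

Definition zquad k (w : 'cV[R]_m) : R :=
  dot (y k) (A *m x k - w) + r / 2 * enorm (A *m x k - w) ^+ 2
  + 2^-1 * wnorm2 (M2 k) (w - z k).

Definition gz k : R := fine (g (z k)).

Lemma g_gtNy w : (-oo < g w)%E. Proof. by case: g_proper. Qed.

(** A minimizer has a finite value because [g] is finite somewhere. *)
Lemma gzE k : g (z k.+1) = (gz k.+1)%:E.
Proof.
have [zmin _ _] := gen k; have [_ [w gw]] := g_proper.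
have := zmin w; rewrite /z_objective /gz.
have := g_gtNy (z k.+1); have := g_gtNy w.
by case: (g w) gw => [a| |] //; case: (g (z k.+1)).
Qed.

Lemma gz_le k w c : g w = c%:E -> gz k.+1 + zquad k (z k.+1) <= c + zquad k w.
Proof.
move=> gw; have [zmin _ _] := gen k.
by have := zmin w; rewrite /z_objective gw gzE -!EFinD lee_fin.
Qed.

(** Around [x k.+1] the objective is at most its value there plus the linear form
    given by the left-hand side plus a quadratic error; minimality leaves no room
    for a nonzero linear form. *)
Lemma xstep_stationary k :
  residual k + A^T *m y k + r *: (A^T *m (A *m x k.+1 - z k.+1)) = 0.
Proof.
have [_ xmin _] := gen k; have [MT _] := M1_psd k.
have [K K0 AK] := mulmx_bounded A.
apply: (@stationary_of_quadratic_ge0 _ _ _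
  (L / 2 + r / 2 * K ^+ 2 + opnorm (M1 k) / 2)) => d.
pose o v := match alg with
  | Algorithm1 => h v
  | Algorithm2 => dot (v - x k) (gradient h (x k))
  end.
have od : o (x k.+1 + d) <= o (x k.+1) + dot (xgrad k) d + L / 2 * dot d d.
  rewrite /o /xgrad; case: alg.
    have := descent_le (x k.+1) (x k.+1 + d) h_diff h_lip.
    by rewrite (addrC (x k.+1)) addrK; lra.
  rewrite (addrAC (x k.+1)) (dotDl (x k.+1 - x k)) (dotC d) lerDl.
  by apply: mulr_ge0 (dot_ge0 _); rewrite divr_ge0 ?(ltW L_gt0).
have := xmin (x k.+1 + d); rewrite /x_objective -/(o _) -/(o _) /residual.
have -> : A *m (x k.+1 + d) - z k.+1 = (A *m x k.+1 - z k.+1) + A *m d.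
  by rewrite mulmxDr addrAC.
have -> : x k.+1 + d - x k = (x k.+1 - x k) + d by rewrite addrAC.
move: (A *m x k.+1 - z k.+1) (x k.+1 - x k) => e dx.
rewrite wnorm2D// sqr_enormD dotDr !dotDl dotZl.
have -> : dot (A^T *m y k) d = dot (y k) (A *m d) by rewrite dot_mulmxl trmxK.
have -> : dot (A^T *m e) d = dot e (A *m d) by rewrite dot_mulmxl trmxK.
have Ad : enorm (A *m d) ^+ 2 <= K ^+ 2 * dot d d.
  by rewrite -sqr_enorm -exprMn ler_pXn2r ?nnegrE ?mulr_ge0 ?enorm_ge0.
have {}Ad := ler_wpM2l (ltW r_gt0) Ad.
have := wnorm2_le (M1 k) d.
lra.
Qed.

(** * Sufficient decrease of the regularized augmented Lagrangian *)

Definition smooth_part (v : 'cV[R]_n) (w p : 'cV[R]_m) : R :=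
  h v + dot p (A *m v - w) + r / 2 * enorm (A *m v - w) ^+ 2.

Definition lagr k : R := gz k + smooth_part (x k) (z k) (y k).

Lemma y_step k : y k.+1 - y k = (rho * r) *: (A *m x k.+1 - z k.+1).
Proof. by have [_ _ ->] := gen k; rewrite addrAC subrr add0r. Qed.

Lemma h_step k :
  - (L / 2 * dot (x k.+1 - x k) (x k.+1 - x k))
  <= h (x k) - h (x k.+1) + dot (xgrad k) (x k.+1 - x k).
Proof.
rewrite /xgrad; case: alg.
  have := descent_ge (x k.+1) (x k) h_diff h_lip.
  by rewrite -opprB !dotNr dotNl opprK; lra.
have := descent_le (x k) (x k.+1) h_diff h_lip; lra.
Qed.

(** Add the decrease in the [z]-step, the decrease in the [x]-step, computed from
    stationarity and the descent lemma, and the increase in the [y]-step. *)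
Lemma lagr_descent k :
  lagr k.+2
    + 2^-1 * wnorm2 (M1 k.+1 *+ 2 + r *: (A^T *m A)) (x k.+2 - x k.+1)
    - L / 2 * dot (x k.+2 - x k.+1) (x k.+2 - x k.+1)
    - (rho * r)^-1 * dot (y k.+2 - y k.+1) (y k.+2 - y k.+1) <= lagr k.+1.
Proof.
set dx := x k.+2 - x k.+1; set dy := y k.+2 - y k.+1.
have := gz_le k.+1 (gzE k); rewrite /zquad subrr.
have -> : wnorm2 (M2 k.+1) 0 = 0 by rewrite /wnorm2 mulmx0 dot0l.
have M2p : 0 <= wnorm2 (M2 k.+1) (z k.+2 - z k.+1).
  have [_ /(_ (z k.+2 - z k.+1))] := M2_psd k.+1.
  by rewrite {1}/wnorm2 mul0mx dot0l.
have := congr1 (fun u => dot u dx) (xstep_stationary k.+1).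
have := h_step k.+1; rewrite -/dx /residual -/dx /lagr /smooth_part.
have dyE : (rho * r)^-1 * dot dy dy = dot dy (A *m x k.+2 - z k.+2).
  by rewrite /dy y_step !dotZl !dotZr; field; rewrite !gt_eqF.
have yE : y k.+2 = y k.+1 + dy by rewrite subrKC.
have -> : A *m x k.+1 - z k.+2 = (A *m x k.+2 - z k.+2) - A *m dx.
  by rewrite /dx mulmxBr [RHS]addrAC subKr.
have WE : wnorm2 (M1 k.+1 *+ 2 + r *: (A^T *m A)) dx =
  2 * dot (M1 k.+1 *m dx) dx + r * enorm (A *m dx) ^+ 2.
  rewrite sqr_enorm /wnorm2 mulmxDl dotDl -scalemxAl dotZl -mulmxA.
  rewrite (dot_mulmxl A^T) trmxK; congr (_ + _).
  by rewrite mulr2n mulmxDl dotDl; ring.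
rewrite WE dyE yE; clearbody dx dy.
move: (A *m x k.+2 - z k.+2) => e.
rewrite !dotDl dotZl dot0l.
have -> : dot (A^T *m y k.+1) dx = dot (y k.+1) (A *m dx).
  by rewrite dot_mulmxl trmxK.
have -> : dot (A^T *m e) dx = dot e (A *m dx) by rewrite dot_mulmxl trmxK.
rewrite sqr_enormD enormN dotBr dotNr.
lra.
Qed.

(** Stationarity says [A^T y k.+1 = (1 - rho) A^T y k - rho residual k]; take
    differences of consecutive instances. *)
Lemma dual_recursion k :
  A^T *m (y k.+2 - y k.+1) = (1 - rho) *: (A^T *m (y k.+1 - y k))
    - rho *: (residual k.+1 - residual k).
Proof.
have E j : rho *: residual j = - (A^T *m (y j.+1 - y j)) - rho *: (A^T *m y j).
  have := congr1 (fun u => rho *: u) (xstep_stationary j).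
  rewrite scaler0 !scalerDr scalerA => /eqP.
  rewrite -addrA addr_eq0 => /eqP ->.
  by rewrite y_step -scalemxAr opprD addrC.
rewrite [in RHS]scalerBr !E !mulmxBr scalerBl scale1r.
move: (A^T *m y k.+2) (A^T *m y k.+1) (A^T *m y k) => a b c.
by apply/matrixP => i j; rewrite !mxE; ring.
Qed.

Lemma residual_lip k : enorm (residual k.+1 - residual k) <=
  modulus_new * enorm (x k.+2 - x k.+1) + modulus_old * enorm (x k.+1 - x k).
Proof.
have M1b : has_ubound (range (fun k => opnorm (M1 k))) by case: assm.
have Mb j d : enorm (M1 j *m d) <= mu * enorm d.
  rewrite (le_trans (opnorm_ub _ _))// ler_wpM2r ?enorm_ge0//.
  exact: opnorm_le_sup.
rewrite /residual opprD addrACA.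
apply: le_trans (enormD _ _) _.
have := enormB (M1 k.+1 *m (x k.+2 - x k.+1)) (M1 k *m (x k.+1 - x k)).
have := Mb k.+1 (x k.+2 - x k.+1); have := Mb k (x k.+1 - x k).
rewrite /xgrad /modulus_new /modulus_old; case: alg.
  have := h_lip (x k.+2) (x k.+1); lra.
have := h_lip (x k.+1) (x k); lra.
Qed.

(** The regularized augmented Lagrangian at [iterate k] below, as a real number;
    the index is shifted because it involves [z k.+1], at which [g] is finite. *)
Definition merit k : R :=
  lagr k.+1 + (2 * T1 A r rho * enorm (A^T *m (y k.+1 - y k)) ^+ 2
               + C1 alg A L r rho mu * enorm (x k.+1 - x k) ^+ 2).

Definition step k : R := enorm (x k.+1 - x k) + enorm (y k.+1 - y k).

Lemma step_ge0 k : 0 <= step k.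
Proof. by rewrite addr_ge0 ?enorm_ge0. Qed.

(** The energy carries [T1] with the factor 2: the increase [|dy|^2 / (rho r)] is
    estimated twice by [relaxation_le], and one copy of [|dy|^2 / (rho r)] is left
    over as decrease in [y]. *)
Lemma merit_decrease :
  exists2 c, 0 < c & forall k, c * step k.+1 ^+ 2 <= merit k - merit k.+1.
Proof.
have [p0 q0 pq0] := moduli_ge0.
have [c c0 cP] := descent_gap p0 q0 pq0.
pose c1 := T0 A rho / r * c; pose c2 := (rho * r)^-1.
have c10 : 0 < c1 by rewrite mulr_gt0 // divr_gt0.
have c20 : 0 < c2 by rewrite invr_gt0 mulr_gt0.
exists (Num.min c1 c2 / 2); first by rewrite divr_gt0 // lt_min c10.
move=> k; rewrite /step /merit.
have := lagr_descent k; rewrite -/c2.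
set dx := x k.+2 - x k.+1; set dy := y k.+2 - y k.+1.
have succ : forall k, mx_succeq (M1 k *+ 2 + r *: (A^T *m A))
    ((L + CM' alg A L rho mu / r)%:M) by case: assm.
have := succ k.+1 dx; rewrite wnorm2_scalar CM'E.
have lamdy : lam * dot dy dy <= dot (A^T *m dy) (A^T *m dy).
  exact: lambda_min_gram_le.
have := relaxation_le rho_itv lam_gt0 r_gt0 (dual_recursion k) lamdy.
rewrite -/lam -[X in _ <= X * _ + _]/(T1 A r rho).
rewrite -[X in _ <= _ + X / r * _]/(T0 A rho) -/c2.
have resid : dot (residual k.+1 - residual k) (residual k.+1 - residual k) <=
    (modulus_new * enorm dx + modulus_old * enorm (x k.+1 - x k)) ^+ 2.
  have := residual_lip k; rewrite -/dx => rl.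
  rewrite -sqr_enorm ler_pXn2r ?nnegrE ?enorm_ge0//.
  by rewrite addr_ge0 ?mulr_ge0 ?enorm_ge0.
have T0r : 0 < T0 A rho / r by rewrite divr_gt0.
have := ler_wpM2l (ltW T0r) resid.
have := ler_wpM2l (ltW T0r) (cP (enorm dx) (enorm (x k.+1 - x k))).
rewrite C1E -!sqr_enorm.
have hmin : Num.min c1 c2 / 2 * (enorm dx + enorm dy) ^+ 2
    <= c1 * enorm dx ^+ 2 + c2 * enorm dy ^+ 2.
  have h1 : Num.min c1 c2 * enorm dx ^+ 2 <= c1 * enorm dx ^+ 2.
    by rewrite ler_wpM2r ?sqr_ge0// ge_min lexx.
  have h2 : Num.min c1 c2 * enorm dy ^+ 2 <= c2 * enorm dy ^+ 2.
    by rewrite ler_wpM2r ?sqr_ge0// ge_min lexx orbT.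
  have mc : 0 < Num.min c1 c2 by rewrite lt_min c10.
  have := mulr_ge0 (ltW mc) (sqr_ge0 (enorm dx - enorm dy)).
  lra.
move: hmin; rewrite /c1.
have -> : 4 * T0 A rho * modulus_old ^+ 2 / r
        = T0 A rho / r * (4 * modulus_old ^+ 2) by ring.
have -> : (10 * modulus_old ^+ 2 + 8 * modulus_new ^+ 2) * T0 A rho / r
        = T0 A rho / r * (10 * modulus_old ^+ 2 + 8 * modulus_new ^+ 2) by ring.
move: (T0 A rho / r) => t.
lra.
Qed.

(** * Convergence of the merit values *)

Let F := reg_aug_lagrangian alg g h A L r rho mu.

Definition iterate k : 'cV[R]_(n + (m + (m + (n + m)))) :=
  stack (x k.+1) (z k.+1) (y k.+1) (x k) (y k).

Lemma F_iterate k : on_stack F (iterate k) = (merit k)%:E.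
Proof.
by rewrite on_stack_stack /F /reg_aug_lagrangian /aug_lagrangian gzE -!EFinD.
Qed.

Lemma merit_lbound : exists b, forall k, b <= merit k.
Proof.
have [bg gb] : exists b : R, forall w, (b%:E <= g w)%E by case: assm.
have [bh hb] : exists b : R, forall v, b <= h v by case: assm.
have [B Bb] := bounded.
have [K K0 AK] := mulmx_bounded A.
exists (bg + bh - B * (K * B + B)) => k; rewrite /merit /lagr /smooth_part.
have g1 : bg <= gz k.+1 by rewrite -lee_fin -gzE gb.
have h1 := hb (x k.+1).
have [xB zB yB] := Bb k.+1.
have B0 : 0 <= B := le_trans (enorm_ge0 _) xB.
have d1 : - (B * (K * B + B)) <= dot (y k.+1) (A *m x k.+1 - z k.+1).
  rewrite lerNl -dotNr (le_trans (dot_le _ _))// enormN.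
  apply: ler_pM => //; rewrite ?enorm_ge0//.
  rewrite (le_trans (enormB _ _))// lerD// (le_trans (AK _))//.
  by rewrite ler_wpM2l.
have := mulr_ge0 (ltW r_gt0) (sqr_ge0 (enorm (A *m x k.+1 - z k.+1))).
have := mulr_ge0 T1_ge0 (sqr_ge0 (enorm (A^T *m (y k.+1 - y k)))).
have := mulr_ge0 C1_ge0 (sqr_ge0 (enorm (x k.+1 - x k))).
lra.
Qed.

Definition merit_lim : R := inf (range merit).

Lemma merit_cvg : merit @ \oo --> merit_lim.
Proof.
have [c c0 cP] := merit_decrease.
apply: nonincreasing_cvgn; last first.
  by have [b bP] := merit_lbound; exists b => _ [k _ <-].
apply/nonincreasing_seqP => k.
have := cP k; have := mulr_ge0 (ltW c0) (sqr_ge0 (step k.+1)); lra.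
Qed.

Definition gap k := merit k - merit_lim.

Lemma gap_ge0 k : 0 <= gap k.
Proof.
rewrite subr_ge0; apply: ge_inf; last by exists k.
by have [b bP] := merit_lbound; exists b => _ [j _ <-].
Qed.

Lemma gap_to0 : tends_to_0 gap.
Proof.
move=> e e0; have /cvgrPdist_lt/(_ e e0)[N _ NP] := merit_cvg.
exists N => k Nk; have := NP k Nk; rewrite /= distrC.
by rewrite ger0_norm // gap_ge0.
Qed.

Lemma step_to0 : tends_to_0 step.
Proof.
have [c c0 cP] := merit_decrease.
apply: (@steps_tend_to_0 _ gap _ c 0%N) => //.
- by move=> k _; exact: gap_ge0.
- exact: step_ge0.
- by move=> k _; have := cP k; rewrite /gap; lra.
- exact: gap_to0.
Qed.

(** * A subgradient at each iterate *)

Lemma feasibility k :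
  A *m x k.+1 - z k.+1 = (rho * r)^-1 *: (y k.+1 - y k).
Proof. by rewrite y_step scalerK // mulf_neq0 // gt_eqF. Qed.

(** The multiplier update determines [z k.+1] from [x k.+1] and [y k.+1 - y k], so
    [step] controls the increments of [z] as well. *)
Lemma z_step_le : exists2 K, 0 <= K &
  forall k, enorm (z k.+2 - z k.+1) <= K * (step k.+1 + step k).
Proof.
have [K K0 AK] := mulmx_bounded A.
have t0 : 0 < (rho * r)^-1 by rewrite invr_gt0 mulr_gt0.
exists (K + (rho * r)^-1); first by rewrite addr_ge0 // ltW.
move=> k.
have zE j : z j.+1 = A *m x j.+1 - (rho * r)^-1 *: (y j.+1 - y j).
  by rewrite -feasibility subKr.
have -> : z k.+2 - z k.+1 = A *m (x k.+2 - x k.+1)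
  - ((rho * r)^-1 *: (y k.+2 - y k.+1) - (rho * r)^-1 *: (y k.+1 - y k)).
  by rewrite !zE mulmxBr !opprD !opprK addrACA.
apply: le_trans (enormB _ _) _.
have := enormB ((rho * r)^-1 *: (y k.+2 - y k.+1)) ((rho * r)^-1 *: (y k.+1 - y k)).
rewrite !enormZ gtr0_norm//; have := AK (x k.+2 - x k.+1); rewrite /step.
have := enorm_ge0 (x k.+2 - x k.+1); have := enorm_ge0 (x k.+1 - x k).
have := enorm_ge0 (y k.+2 - y k.+1); have := enorm_ge0 (y k.+1 - y k).
move: (enorm (x k.+2 - x k.+1)) (enorm (x k.+1 - x k))
  (enorm (y k.+2 - y k.+1)) (enorm (y k.+1 - y k)) => a b c d d0 c0 b0 a0.
have := mulr_ge0 K0 b0; have := mulr_ge0 K0 c0; have := mulr_ge0 K0 d0.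
have := mulr_ge0 (ltW t0) a0; have := mulr_ge0 (ltW t0) b0.
lra.
Qed.

(* Partial gradients of the energy at [iterate k]; in [subgrad_z] the first three
   terms are the subgradient of [g] at [z k.+1] given by the [z]-subproblem. *)
Definition subgrad_x k : 'cV[R]_n :=
  gradient h (x k.+1) + A^T *m y k.+1
  + r *: (A^T *m (A *m x k.+1 - z k.+1))
  + (2 * C1 alg A L r rho mu) *: (x k.+1 - x k).

Definition subgrad_z k : 'cV[R]_m :=
  y k + r *: (A *m x k - z k.+1) - M2 k *m (z k.+1 - z k)
  - y k.+1 - r *: (A *m x k.+1 - z k.+1).

Definition subgrad_y k : 'cV[R]_m :=
  A *m x k.+1 - z k.+1
  + (4 * T1 A r rho) *: (A *m (A^T *m (y k.+1 - y k))).

Definition subgrad_x' k : 'cV[R]_n :=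
  - ((2 * C1 alg A L r rho mu) *: (x k.+1 - x k)).

Definition subgrad_y' k : 'cV[R]_m :=
  - ((4 * T1 A r rho) *: (A *m (A^T *m (y k.+1 - y k)))).

Definition subgrad k :=
  stack (subgrad_x k) (subgrad_z k) (subgrad_y k) (subgrad_x' k) (subgrad_y' k).

(** Expand the energy around [iterate k]. The first order terms are those of
    [subgrad k]; of the second order terms, the squares with positive coefficients
    are dropped, and the coupling of the [y]-increment with the constraint is
    absorbed by the penalty at the price of [|.|^2 / (2 r)] ([young]). *)
Lemma subgrad_frechet k :
  frechet_subdiff (on_stack F) (iterate k) (subgrad k).
Proof.
pose K := L / 2 + (r / 2 + opnorm (M2 k) / 2) + r^-1 / 2.
have M20 := opnorm_ge0 (M2 k).
apply: (@frechet_of_quadratic_minorant _ _ _ _ _ (merit k) K).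
- by rewrite !addr_ge0 ?divr_ge0 ?invr_ge0// ltW.
- exact: F_iterate.
move=> v; have [d1 [d2 [d3 [d4 [d5 dE]]]]] := stackP (v - iterate k).
have vE : v = stack (x k.+1 + d1) (z k.+1 + d2) (y k.+1 + d3) (x k + d4) (y k + d5).
  by rewrite -[v](subrKC (iterate k)) dE /iterate /stack !add_col_mx.
rewrite dE vE on_stack_stack /F /reg_aug_lagrangian /aug_lagrangian {v dE vE}.
have := g_gtNy (z k.+1 + d2); case gw : (g _) => [c| |] //= _; last first.
  by rewrite leey.
rewrite lee_fin.
have [dd1 dd2 dd3] := dot_stack_parts_le d1 d2 d3 d4 d5.
move: (dot (stack d1 d2 d3 d4 d5) _) dd1 dd2 dd3 => N2 dd1 dd2 dd3.
rewrite /subgrad dot_stack.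
have := gz_le k gw; rewrite /zquad.
have -> : A *m x k - (z k.+1 + d2) = (A *m x k - z k.+1) - d2.
  by rewrite opprD addrA.
have -> : z k.+1 + d2 - z k = (z k.+1 - z k) + d2 by rewrite addrAC.
have -> : A *m (x k.+1 + d1) - (z k.+1 + d2)
        = (A *m x k.+1 - z k.+1) + (A *m d1 - d2).
  by rewrite mulmxDr opprD addrACA.
have -> : x k.+1 + d1 - (x k + d4) = (x k.+1 - x k) + (d1 - d4).
  by rewrite opprD addrACA.
have -> : A^T *m (y k.+1 + d3 - (y k + d5))
        = A^T *m (y k.+1 - y k) + (A^T *m d3 - A^T *m d5).
  by rewrite opprD addrACA mulmxDr (mulmxBr _ d3).
have [M2T _] := M2_psd k.
have hd := descent_ge (x k.+1) (x k.+1 + d1) h_diff h_lip.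
rewrite addrAC subrr add0r in hd.
rewrite /merit /lagr /smooth_part /subgrad_x /subgrad_z /subgrad_y
  /subgrad_x' /subgrad_y' /K.
have := wnorm2_le (M2 k) d2.
have m2 := ler_wpM2l M20 dd2; have r2 := ler_wpM2l (ltW r_gt0) dd2.
have L1 := ler_wpM2l (ltW L_gt0) dd1.
have r0 : 0 <= r^-1 by rewrite invr_ge0 ltW.
have r3 := ler_wpM2l r0 dd3.
have young : 0 <= r^-1 * dot d3 d3 + 2 * dot d3 (A *m d1 - d2)
                  + r * dot (A *m d1 - d2) (A *m d1 - d2).
  move: (A *m d1 - d2) => f; have := mulr_ge0 r0 (dot_ge0 (d3 + r *: f)).
  rewrite dotDl !dotDr !dotZl !dotZr (dotC f d3).
  suff -> : r^-1 * (dot d3 d3 + r * dot d3 f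
      + (r * dot d3 f + r * (r * dot f f)))
    = r^-1 * dot d3 d3 + 2 * dot d3 f + r * dot f f by [].
  by field; rewrite gt_eqF.
have adj (u : 'cV[R]_m) (d : 'cV[R]_n) : dot (A^T *m u) d = dot u (A *m d).
  by rewrite dot_mulmxl trmxK.
have adj' (u : 'cV[R]_n) (d : 'cV[R]_m) : dot (A *m u) d = dot u (A^T *m d).
  by rewrite dot_mulmxl.
have fE w : dot w (A *m d1 - d2) = dot w (A *m d1) - dot w d2 by rewrite dotBr.
have bE w : dot w (A^T *m d3 - A^T *m d5) = dot w (A^T *m d3) - dot w (A^T *m d5).
  by rewrite dotBr.
have cE w : dot w (d1 - d4) = dot w d1 - dot w d4 by rewrite dotBr.
have T1n := mulr_ge0 T1_ge0 (dot_ge0 (A^T *m d3 - A^T *m d5)).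
have C1n := mulr_ge0 C1_ge0 (dot_ge0 (d1 - d4)).
move: (A *m d1 - d2) (A^T *m d3 - A^T *m d5) (d1 - d4) young T1n C1n fE bE cE
  => f b cc young T1n C1n fE bE cE.
move: (A *m x k.+1 - z k.+1) (A *m x k - z k.+1) (x k.+1 - x k) (z k.+1 - z k)
   (A^T *m (y k.+1 - y k)) => e e' dx dz a.
rewrite wnorm2D// !sqr_enormD !sqr_enorm !(dotDl, dotNl, dotZl, adj, adj').
rewrite (dotBr (y k)) (dotDr (y k.+1)) (dotDr d3) (dotC d3 e) !dotNr opprK !fE !bE !cE.
rewrite !fE in young; rewrite bE in T1n; rewrite cE in C1n.
lra.
Qed.

(** Subtracting the stationarity of [x k.+2] from [subgrad_x] leaves increments of
    the iterates only; the constraint residual is an increment of [y]. *)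
Lemma subgrad_le : exists2 C, 0 <= C &
  forall k, enorm (subgrad k.+1) <= C * (step k.+1 + step k).
Proof.
have [K K0 AK] := mulmx_bounded A.
have [K' K'0 AK'] := mulmx_bounded A^T.
have [Kz Kz0 zK] := z_step_le.
have M2b : has_ubound (range (fun k => opnorm (M2 k))) by case: assm.
have M1b : has_ubound (range (fun k => opnorm (M1 k))) by case: assm.
pose mu2 := sup_opnorm M2.
have mu20 : 0 <= mu2 := le_trans (opnorm_ge0 (M2 0)) (opnorm_le_sup M2b 0).
have mu0 := mu_ge0.
pose c1 := C1 alg A L r rho mu; pose t1 := T1 A r rho.
have c2 : 0 <= 2 * c1 := mulr_ge0 (ler0n _ 2) C1_ge0.
have t4 : 0 <= 4 * t1 := mulr_ge0 (ler0n _ 4) T1_ge0.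
have tK := mulr_ge0 t4 (mulr_ge0 K0 K'0).
have q0 : 0 < (rho * r)^-1 by rewrite invr_gt0 mulr_gt0.
have [L0 r0] := (ltW L_gt0, ltW r_gt0).
pose Cx := L + mu + K' + 2 * c1; pose Cz := 1 + r * K + mu2 * Kz.
pose Cy := (rho * r)^-1 + 4 * t1 * (K * K').
have Cx0 : 0 <= Cx by rewrite /Cx; lra.
have Cz0 : 0 <= Cz.
  by have := mulr_ge0 r0 K0; have := mulr_ge0 mu20 Kz0; rewrite /Cz; lra.
have Cy0 : 0 <= Cy by rewrite /Cy; lra.
exists (Cx + Cz + Cy + 2 * c1 + 4 * t1 * (K * K')).
  lra.
move=> k; set S := step k.+1 + step k.
have S0 : 0 <= S by rewrite addr_ge0 ?step_ge0.
set dx := x k.+2 - x k.+1; set dy := y k.+2 - y k.+1.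
have [dxS dyS] : enorm dx <= S /\ enorm dy <= S.
  rewrite /S /step -/dx -/dy.
  have := (enorm_ge0 dx, enorm_ge0 dy).
  have := (enorm_ge0 (x k.+1 - x k), enorm_ge0 (y k.+1 - y k)).
  by move=> [a0 b0] [c0 d0]; split; lra.
have dzS : enorm (z k.+2 - z k.+1) <= Kz * S by exact: zK.
apply: le_trans (enorm_stack_le _ _ _ _ _) _.
have AAdy : enorm (A *m (A^T *m dy)) <= K * K' * S.
  rewrite (le_trans (AK _))// -mulrA ler_wpM2l// (le_trans (AK' _))//.
  by rewrite ler_wpM2l.
have ZAA : enorm ((4 * t1) *: (A *m (A^T *m dy))) <= 4 * t1 * (K * K') * S.
  by rewrite enormZ ger0_norm// -[leRHS]mulrA ler_wpM2l.
have Zx : enorm ((2 * c1) *: dx) <= 2 * c1 * S.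
  by rewrite enormZ ger0_norm// ler_wpM2l.
have bx : enorm (subgrad_x k.+1) <= Cx * S.
  have E : subgrad_x k.+1 = (gradient h (x k.+2) - xgrad k.+1)
      - M1 k.+1 *m dx + A^T *m dy + (2 * c1) *: dx.
    rewrite /subgrad_x -/dx -/c1; congr (_ + _).
    have := xstep_stationary k.+1; rewrite /residual -/dx => E0.
    rewrite -[LHS]subr0 -{}E0 /dy (mulmxBr _ (y k.+2)).
    move: (A^T *m y k.+2) (A^T *m y k.+1) (M1 k.+1 *m dx) (r *: _)
      (gradient h (x k.+2)) (xgrad k.+1) => a b c d e f.
    by apply/matrixP => i j; rewrite !mxE; ring.
  have hg : enorm (gradient h (x k.+2) - xgrad k.+1) <= L * S.
    rewrite /xgrad; case: alg; first by rewrite subrr enorm0 mulr_ge0.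
    by rewrite (le_trans (h_lip _ _))// ler_wpM2l.
  have hM : enorm (M1 k.+1 *m dx) <= mu * S.
    rewrite (le_trans (opnorm_ub _ _))//.
    by apply: ler_pM; rewrite ?opnorm_ge0 ?enorm_ge0 ?opnorm_le_sup.
  have hA : enorm (A^T *m dy) <= K' * S by rewrite (le_trans (AK' _))// ler_wpM2l.
  rewrite E (le_trans (enormD _ _))// (le_trans (lerD (enormD _ _) (lexx _)))//.
  have := enormB (gradient h (x k.+2) - xgrad k.+1) (M1 k.+1 *m dx).
  rewrite /Cx; lra.
have bz : enorm (subgrad_z k.+1) <= Cz * S.
  have E : subgrad_z k.+1 = - dy - r *: (A *m dx)
      - M2 k.+1 *m (z k.+2 - z k.+1).
    rewrite /subgrad_z /dy /dx (mulmxBr A).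
    move: (A *m x k.+2) (A *m x k.+1) (M2 k.+1 *m _) => a b c.
    by apply/matrixP => i j; rewrite !mxE; ring.
  have hM : enorm (M2 k.+1 *m (z k.+2 - z k.+1)) <= mu2 * Kz * S.
    rewrite (le_trans (opnorm_ub _ _))// -mulrA.
    by apply: ler_pM; rewrite ?opnorm_ge0 ?enorm_ge0 ?opnorm_le_sup.
  have hA : enorm (r *: (A *m dx)) <= r * K * S.
    rewrite enormZ gtr0_norm// -mulrA ler_wpM2l// (le_trans (AK _))//.
    by rewrite ler_wpM2l.
  rewrite E (le_trans (enormB _ _))// (le_trans (lerD (enormB _ _) (lexx _)))//.
  rewrite enormN /Cz; lra.
have by_ : enorm (subgrad_y k.+1) <= Cy * S.
  have hq : enorm ((rho * r)^-1 *: dy) <= (rho * r)^-1 * S.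
    by rewrite enormZ gtr0_norm// ler_wpM2l// ltW.
  rewrite /subgrad_y -/t1 -/dy feasibility -/dy.
  apply: le_trans (enormD _ _) _; rewrite /Cy; lra.
have bx' : enorm (subgrad_x' k.+1) <= 2 * c1 * S by rewrite enormN.
have by' : enorm (subgrad_y' k.+1) <= 4 * t1 * (K * K') * S by rewrite enormN.
lra.
Qed.

(** * Cluster points of the iterates are critical *)

Definition dist_to xh zh yh k : R :=
  enorm (x k.+1 - xh) + enorm (z k.+1 - zh) + enorm (y k.+1 - yh)
  + enorm (x k - xh) + enorm (y k - yh).

Lemma dist_to_move xh zh yh : exists2 K, 0 <= K & forall k,
  dist_to xh zh yh k.+1 <= dist_to xh zh yh k + K * (step k.+1 + step k).
Proof.
have [K K0 zK] := z_step_le.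
exists (K + 1); first by rewrite addr_ge0.
move=> k; have := zK k; rewrite /dist_to /step.
have := enorm_triangle (x k.+1) (x k.+2) xh.
have := enorm_triangle (x k) (x k.+1) xh.
have := enorm_triangle (y k.+1) (y k.+2) yh.
have := enorm_triangle (y k) (y k.+1) yh.
have := enorm_triangle (z k.+1) (z k.+2) zh.
lra.
Qed.

(** The components with index [k] have the same cluster point as those with index
    [k.+1], since [step] tends to 0. *)
Lemma dist_to_cluster : exists xh zh yh, forall e, 0 < e ->
  forall N, exists2 k, (N <= k)%N & dist_to xh zh yh k < e.
Proof.
have [B Bb] := bounded.
pose U k : 'cV[R]_(n + (m + m)) := col_mx (x k) (col_mx (z k) (y k)).
have UE k : dot (U k) (U k) = dot (x k) (x k) + (dot (z k) (z k) + dot (y k) (y k)).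
  by rewrite !dot_col_mx.
have UB k : enorm (U k) <= 3 * B.
  have [xB zB yB] := Bb k.
  have B0 := le_trans (enorm_ge0 _) xB.
  have sq N (u : 'cV[R]_N) : enorm u <= B -> dot u u <= B ^+ 2.
    by rewrite -sqr_enorm ler_pXn2r ?nnegrE ?enorm_ge0.
  apply: enorm_le; first by rewrite mulr_ge0.
  rewrite UE; have := sq _ _ xB; have := sq _ _ zB; have := sq _ _ yB.
  have := sqr_ge0 B; lra.
have [l lU] := bounded_has_cluster UB.
pose xh := usubmx l; pose zh := usubmx (dsubmx l); pose yh := dsubmx (dsubmx l).
have lE : l = col_mx xh (col_mx zh yh) by rewrite !vsubmxK.
exists xh, zh, yh => e e0 N.
have e7 : 0 < e / 7 by rewrite divr_gt0.
have [K KP] := step_to0 e7.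
have [[//|k] kN Ul] := lU _ e7 (maxn N K).+1.
move: kN; rewrite ltnS geq_max => /andP[Nk Kk]; exists k => //.
have := KP _ Kk; rewrite /step /dist_to.
have dE : dot (U k.+1 - l) (U k.+1 - l) = dot (x k.+1 - xh) (x k.+1 - xh)
    + (dot (z k.+1 - zh) (z k.+1 - zh) + dot (y k.+1 - yh) (y k.+1 - yh)).
  by rewrite lE /U !opp_col_mx !add_col_mx !dot_col_mx.
have lee N' (u : 'cV[R]_N') : dot u u <= dot (U k.+1 - l) (U k.+1 - l) ->
    enorm u <= e / 7.
  rewrite -sqr_enorm -[leRHS]sqr_enorm ler_pXn2r ?nnegrE ?enorm_ge0// => h'.
  exact: le_trans h' (ltW Ul).
have xx := dot_ge0 (x k.+1 - xh); have zz := dot_ge0 (z k.+1 - zh).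
have yy := dot_ge0 (y k.+1 - yh).
have := lee _ (x k.+1 - xh); have := lee _ (z k.+1 - zh).
have := lee _ (y k.+1 - yh); rewrite dE.
move=> /(_ ltac:(lra)) ly /(_ ltac:(lra)) lz /(_ ltac:(lra)) lx.
have := enorm_triangle (x k.+1) (x k) xh.
have := enorm_triangle (y k.+1) (y k) yh.
rewrite (enormC (x k) (x k.+1)) (enormC (y k) (y k.+1)); lra.
Qed.

Lemma on_stack_F xh zh yh : on_stack F (stack xh zh yh xh yh) =
  (g zh + (smooth_part xh zh yh)%:E)%E.
Proof.
rewrite on_stack_stack /F /reg_aug_lagrangian /aug_lagrangian !subrr mulmx0.
by rewrite !enorm0 expr0n /= !mulr0 addr0 adde0.
Qed.

Lemma penalty_cvg (v : nat -> 'cV[R]_n) (w p : nat -> 'cV[R]_m)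
    (vh : 'cV[R]_n) (wh ph : 'cV[R]_m) :
  v @ \oo --> vh -> w @ \oo --> wh -> p @ \oo --> ph ->
  (fun j => dot (p j) (A *m v j - w j) + r / 2 * enorm (A *m v j - w j) ^+ 2)
    @ \oo --> dot ph (A *m vh - wh) + r / 2 * enorm (A *m vh - wh) ^+ 2.
Proof.
move=> vv ww pp.
have e : (fun j => A *m v j - w j) @ \oo --> A *m vh - wh.
  by apply: cvgB => //; exact: cvg_mulmxl.
apply: cvgD; first exact: cvg_dot.
by apply: cvgMl_tmp; exact: cvg_sqr_enorm.
Qed.

(** Along a subsequence converging to the cluster point, the values of [g]
    converge; lower semicontinuity bounds the limit from below, and comparing
    [z k.+1] with the cluster point in the [z]-subproblem bounds it from
    above. *)
Lemma cluster_critical xh zh yh :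
  (forall e, 0 < e -> forall N, exists2 k, (N <= k)%N & dist_to xh zh yh k < e) ->
  on_stack F (stack xh zh yh xh yh) = merit_lim%:E /\
  limiting_subdiff (on_stack F) (stack xh zh yh xh yh) 0.
Proof.
move=> clu.
have [C C0 DC] := subgrad_le; have [Kz Kz0 zK] := z_step_le.
have CK0 : 0 < 2 * (C + Kz + 1) by lra.
(* [kk] extracts a subsequence along which the subgradients vanish too. The
   bound on [z (kk j).+1] controls the proximal term of the [z]-subproblem. *)
have /choice[kk kkP] : forall j, exists k,
    [/\ (j <= k)%N, dist_to xh zh yh k.+1 < j.+1%:R^-1,
      enorm (subgrad k.+1) < j.+1%:R^-1
      & enorm (z k.+1 - zh) < 2 * j.+1%:R^-1].
  move=> j; have j0 : 0 < j.+1%:R^-1 :> R by rewrite invr_gt0 ltr0n.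
  move: (j.+1%:R^-1 : R) j0 => t j0.
  have [K KP] := step_to0 (divr_gt0 j0 CK0).
  have [[//|k]] := clu _ j0 (maxn j K).+1.
  rewrite ltnS geq_max => /andP[jk Kk] dk; exists k.
  have st : (C + Kz + 1) * (step k.+1 + step k) < t.
    have := KP _ (leq_trans Kk (leqnSn k)); have := KP _ Kk.
    rewrite !ltr_pdivlMr//; lra.
  have s0 : 0 <= step k.+1 + step k by rewrite addr_ge0 ?step_ge0.
  have [Cs Ks] := (mulr_ge0 C0 s0, mulr_ge0 Kz0 s0).
  split=> //; first by rewrite (le_lt_trans (DC _))//; lra.
  have := enorm_triangle (z k.+2) (z k.+1) zh.
  rewrite (enormC (z k.+1) (z k.+2)); have := zK k.
  have : enorm (z k.+2 - zh) <= dist_to xh zh yh k.+1.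
    rewrite /dist_to.
    have := (enorm_ge0 (x k.+2 - xh), enorm_ge0 (y k.+2 - yh)).
    have := (enorm_ge0 (x k.+1 - xh), enorm_ge0 (y k.+1 - yh)).
    by move=> [a b] [c d]; lra.
  lra.
have dle j : [/\ enorm (x (kk j).+2 - xh) < j.+1%:R^-1,
    enorm (z (kk j).+2 - zh) < j.+1%:R^-1,
    enorm (y (kk j).+2 - yh) < j.+1%:R^-1,
    enorm (x (kk j).+1 - xh) < j.+1%:R^-1
    & enorm (y (kk j).+1 - yh) < j.+1%:R^-1].
  have [_ dk _ _] := kkP j; move: dk; rewrite /dist_to.
  move: (j.+1%:R^-1 : R) => t.
  have := (enorm_ge0 (x (kk j).+2 - xh), enorm_ge0 (y (kk j).+2 - yh)).
  have := (enorm_ge0 (x (kk j).+1 - xh), enorm_ge0 (y (kk j).+1 - yh)).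
  have := enorm_ge0 (z (kk j).+2 - zh).
  by move=> e [a b] [c d] dk; split; lra.
have xs : (fun j => x (kk j).+2) @ \oo --> xh.
  by apply: cvg_enorm_harmonic => j; case: (dle j).
have zs : (fun j => z (kk j).+2) @ \oo --> zh.
  by apply: cvg_enorm_harmonic => j; case: (dle j).
have ys : (fun j => y (kk j).+2) @ \oo --> yh.
  by apply: cvg_enorm_harmonic => j; case: (dle j).
have xs' : (fun j => x (kk j).+1) @ \oo --> xh.
  by apply: cvg_enorm_harmonic => j; case: (dle j).
have ys' : (fun j => y (kk j).+1) @ \oo --> yh.
  by apply: cvg_enorm_harmonic => j; case: (dle j).
have zs' : (fun j => z (kk j).+1) @ \oo --> zh.
  apply/cvg_enormP => e e0.
  have [K _ KP] := near_infty_natSinv_lt (PosNum (divr_gt0 e0 (ltr0n R 2))).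
  exists K => j /KP /= je; have [_ _ _ zj] := kkP j; move: zj je.
  move: (j.+1%:R^-1 : R) => t.
  by rewrite ltr_pdivlMr//; lra.
have smooth_cvg : (fun j => smooth_part (x (kk j).+2) (z (kk j).+2) (y (kk j).+2))
    @ \oo --> smooth_part xh zh yh.
  rewrite /smooth_part (eq_cvg _ _ (fun j => esym (addrA _ _ _))) -addrA.
  apply: cvgD; last exact: penalty_cvg.
  exact: (cvg_comp _ _ xs (differentiable_continuous (h_diff xh))).
have merit_sub : (fun j => merit (kk j).+1) @ \oo --> merit_lim.
  apply/cvgrPdist_lt => e e0.
  have /cvgrPdist_lt/(_ e e0)[N _ NP] := merit_cvg.
  exists N => // j /= Nj; apply: NP => /=.
  by have [jk _ _ _] := kkP j; rewrite (leq_trans Nj)// ltnW.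
have g_cvg : (fun j => gz (kk j).+2) @ \oo --> merit_lim - smooth_part xh zh yh.
  have rest : (fun j => 2 * T1 A r rho
        * enorm (A^T *m (y (kk j).+2 - y (kk j).+1)) ^+ 2
      + C1 alg A L r rho mu * enorm (x (kk j).+2 - x (kk j).+1) ^+ 2)
      @ \oo --> (0 : R).
    have -> : 0 = 2 * T1 A r rho * enorm (A^T *m (yh - yh)) ^+ 2
        + C1 alg A L r rho mu * enorm (xh - xh) ^+ 2.
      by rewrite !subrr mulmx0 !enorm0 expr0n /= !mulr0 addr0.
    apply: cvgD; apply: cvgMl_tmp; apply: cvg_sqr_enorm.
      by apply: cvg_mulmxl; exact: cvgB.
    exact: cvgB.
  rewrite -[_ - _]subr0.
  apply: cvg_trans (cvgB (cvgB merit_sub smooth_cvg) rest).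
  by apply: near_eq_cvg; near=> j; rewrite !fctE /merit /lagr; ring.
have [c gc] : exists c, g zh = c%:E /\ c <= merit_lim - smooth_part xh zh yh.
  set G := _ - _ in g_cvg *.
  have gG : (g zh <= G%:E)%E.
    rewrite leNgt; apply/negP => Gg.
    have [a Ga ag] : exists2 a, G < a & (a%:E < g zh)%E.
      move: Gg; case: (g zh) => [c| |] //.
        rewrite lte_fin => Gc; exists ((G + c) / 2); rewrite ?lte_fin; lra.
      by move=> _; exists (G + 1); rewrite ?ltry//; lra.
    have [V Vz Vg] := g_lsc ag.
    have : a <= G.
      apply: (cvgr_to_ge g_cvg); near=> j.
      rewrite -lee_fin -gzE; apply/ltW/Vg; near: j; exact: (zs _ Vz).
    lra.
  have := g_gtNy zh; case: (g zh) gG => [c| |] //.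
  by rewrite lee_fin => cG _; exists c.
case: gc => gc cG.
(* Pass to the limit in the comparison of [z (kk j).+2] with [zh]. *)
have Gc : merit_lim - smooth_part xh zh yh <= c.
  pose P w j := dot (y (kk j).+1) (A *m x (kk j).+1 - w)
    + r / 2 * enorm (A *m x (kk j).+1 - w) ^+ 2.
  have Pz : (fun j => P (z (kk j).+2) j) @ \oo -->
      dot yh (A *m xh - zh) + r / 2 * enorm (A *m xh - zh) ^+ 2.
    exact: penalty_cvg.
  have Ph : P zh @ \oo -->
      dot yh (A *m xh - zh) + r / 2 * enorm (A *m xh - zh) ^+ 2.
    by apply: penalty_cvg => //; exact: cvg_cst.
  have M2b : has_ubound (range (fun k => opnorm (M2 k))) by case: assm.
  have Mz : (fun j => 2^-1 * (sup_opnorm M2 * enorm (zh - z (kk j).+1) ^+ 2))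
      @ \oo --> (0 : R).
    have -> : 0 = 2^-1 * (sup_opnorm M2 * enorm (zh - zh) ^+ 2).
      by rewrite subrr enorm0 expr0n /= !mulr0.
    do 2 apply: cvgMl_tmp; apply: cvg_sqr_enorm; apply: cvgB => //.
    exact: cvg_cst.
  pose l := dot yh (A *m xh - zh) + r / 2 * enorm (A *m xh - zh) ^+ 2.
  have lim1 : (fun j => gz (kk j).+2 + P (z (kk j).+2) j) @ \oo -->
      merit_lim - smooth_part xh zh yh + l by exact: cvgD.
  have lim2 : (fun j => c + P zh j
        + 2^-1 * (sup_opnorm M2 * enorm (zh - z (kk j).+1) ^+ 2)) @ \oo -->
      c + l + 0.
    by apply: cvgD => //; apply: cvgD => //; exact: cvg_cst.
  have := ler_cvg_to lim1 lim2; rewrite addr0 lerD2r; apply.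
  near=> j; have := gz_le (kk j).+1 gc; rewrite /zquad -/(P _ _) -/(P zh _) /=.
  have [_ /(_ (z (kk j).+2 - z (kk j).+1))] := M2_psd (kk j).+1.
  rewrite {1}/wnorm2 mul0mx dot0l.
  have := wnorm2_le (M2 (kk j).+1) (zh - z (kk j).+1).
  have := ler_wpM2r (dot_ge0 (zh - z (kk j).+1)) (opnorm_le_sup M2b (kk j).+1).
  rewrite sqr_enorm; lra.
have Fh : on_stack F (stack xh zh yh xh yh) = merit_lim%:E.
  by rewrite on_stack_F gc -EFinD; congr (_%:E); lra.
split=> //; split; first by rewrite Fh ltry.
exists (fun j => iterate (kk j).+1), (fun j => subgrad (kk j).+1); split.
- apply: cvg_enorm_harmonic => j; have [_ dk _ _] := kkP j.
  apply: le_lt_trans dk; rewrite /iterate stackB.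
  exact: enorm_stack_le.
- apply: cvg_enorm_harmonic => j; rewrite subr0; by have [] := kkP j.
- rewrite Fh (eq_cvg _ _ (fun j => F_iterate (kk j).+1)).
  exact: (cvg_comp _ _ merit_sub).
- by move=> j; exact: subgrad_frechet.
Unshelve. all: by end_near. Qed.

(** * From the Lojasiewicz inequality to rates *)

Lemma gap_pow_le : exists2 C, 0 < C & forall CL theta eps u k, 0 < CL ->
  lojasiewicz_ineq (on_stack F) merit_lim%:E u CL theta eps ->
  enorm (iterate k.+1 - u) < eps -> gap k.+1 != 0 ->
  gap k.+1 `^ theta <= CL * C * (step k.+1 + step k).
Proof.
have [C C0 DC] := subgrad_le.
exists (C + 1) => [|CL theta eps u k CL0 loj ku gk]; first by rewrite ltr_wpDl.
have := loj _ ku; rewrite F_iterate -EFinB -/(gap _) /lpow abse_EFin.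
rewrite eqe normr_eq0 (negbTE gk) poweR_EFin ger0_norm ?gap_ge0// => h1.
have h2 := edist0_le (frechet_limiting (subgrad_frechet k.+1)).
have h3 : (CL%:E * Defs.edist 0 (limiting_subdiff (on_stack F) (iterate k.+1))
    <= CL%:E * (enorm (subgrad k.+1))%:E)%E.
  by rewrite lee_pmul2l ?lte_fin.
have := le_trans h1 h3; rewrite -EFinM lee_fin => h4.
rewrite (le_trans h4)// -mulrA ler_wpM2l ?(ltW CL0)// (le_trans (DC k))//.
have := addr_ge0 (step_ge0 k.+1) (step_ge0 k); lra.
Qed.

Lemma enorm_iterate_le xh zh yh k :
  enorm (iterate k - stack xh zh yh xh yh) <= dist_to xh zh yh k.
Proof. by rewrite /iterate stackB; exact: enorm_stack_le. Qed.

Lemma iterates_converge : lojasiewicz_property (on_stack F) ->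
  exists xh zh yh, tends_to_0 (dist_to xh zh yh).
Proof.
move=> lojF; have [xh [zh [yh clu]]] := dist_to_cluster.
have [Fh crit] := cluster_critical clu.
have [CL [theta [eps [CL0 th eps0]]]] := lojF _ crit; rewrite Fh => loj.
have [C C0 CP] := gap_pow_le; have [c c0 cP] := merit_decrease.
have [K K0 KP] := dist_to_move xh zh yh.
exists xh, zh, yh.
apply: (@cluster_trap _ gap step _ theta c (CL * C) K eps 0%N) => //.
- by rewrite mulr_ge0 ?(ltW CL0) ?(ltW C0).
- by move=> k _; exact: gap_ge0.
- exact: step_ge0.
- by move=> k _; have := cP k; rewrite /gap; lra.
- move=> k _ dk; apply: CP CL0 loj _ => //.
  exact: le_lt_trans (enorm_iterate_le _ _ _ _) dk.
- exact: gap_to0.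
Qed.

(** Square the Lojasiewicz inequality and bound the two squared steps by the
    decreases that they cause; these add up to [gap k - gap k.+2]. *)
Lemma gap_recursion xh zh yh CL theta eps : 0 < CL -> 0 < eps ->
  tends_to_0 (dist_to xh zh yh) ->
  lojasiewicz_ineq (on_stack F) merit_lim%:E (stack xh zh yh xh yh) CL theta eps ->
  exists2 M, 0 < M & exists N, forall k, (N <= k)%N -> gap k.+2 != 0 ->
    (gap k.+2 `^ theta) ^+ 2 <= M * (gap k - gap k.+2).
Proof.
move=> CL0 eps0 d0 loj.
have [C C0 CP] := gap_pow_le; have [c c0 cP] := merit_decrease.
have [N NP] := d0 _ eps0.
have D0 : 0 < CL * C by rewrite mulr_gt0.
exists (2 * (CL * C) ^+ 2 / c); first by rewrite divr_gt0 ?mulr_gt0 ?exprn_gt0.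
exists N => k Nk gk.
have dk : enorm (iterate k.+2 - stack xh zh yh xh yh) < eps.
  apply: le_lt_trans (enorm_iterate_le _ _ _ _) (NP _ _).
  by rewrite ltnW // ltnW.
have := CP _ _ _ _ _ CL0 loj dk gk.
rewrite -(@ler_pXn2r _ 2) ?nnegrE ?powR_ge0//; last first.
  by rewrite mulr_ge0 ?(ltW D0)// addr_ge0 ?step_ge0.
move=> /le_trans; apply; rewrite exprMn.
have -> : 2 * (CL * C) ^+ 2 / c * (gap k - gap k.+2)
        = (CL * C) ^+ 2 * (2 * (gap k - gap k.+2) / c) by ring.
rewrite ler_wpM2l ?sqr_ge0// ler_pdivlMr//.
have := cP k; have := cP k.+1; rewrite /gap.
have := mulr_ge0 (ltW c0) (sqr_ge0 (step k.+2 - step k.+1)); lra.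
Qed.

Lemma dist_to_cvg xh zh yh : tends_to_0 (dist_to xh zh yh) ->
  [/\ x @ \oo --> xh, z @ \oo --> zh & y @ \oo --> yh].
Proof.
move=> d0.
have comp N (u : nat -> 'cV[R]_N) l :
    (forall k, enorm (u k.+1 - l) <= dist_to xh zh yh k) -> u @ \oo --> l.
  move=> ul; apply/cvg_enormP => e /d0[K KP]; exists K.+1 => -[//|k].
  by rewrite ltnS => /KP; exact: le_lt_trans (ul k).
have e0 k := (enorm_ge0 (x k.+1 - xh), enorm_ge0 (z k.+1 - zh),
  enorm_ge0 (y k.+1 - yh), enorm_ge0 (x k - xh), enorm_ge0 (y k - yh)).
by split; apply: comp => k; have [[[[a b] c] d] e] := e0 k;
  rewrite /dist_to; lra.
Qed.

Let Fk k : \bar R := F (x k) (z k) (y k) (x k.-1) (y k.-1).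

Lemma FkE k : Fk k.+1 = (merit k)%:E.
Proof. by have := F_iterate k; rewrite on_stack_stack. Qed.

Lemma Fk_lim : limn Fk = merit_lim%:E.
Proof.
apply: cvg_lim; first exact: ereal_hausdorff.
rewrite -cvg_shiftS (eq_cvg _ _ FkE).
exact: (cvg_comp _ _ merit_cvg).
Qed.

Lemma convergence_rates CL theta : 0 < CL -> 0 <= theta < 1 ->
  lojasiewicz_with (on_stack F) (limn Fk) x z y CL theta ->
  [/\ theta = 0 ->
        exists2 k0 : nat, (1 <= k0)%N &
          forall k, (k0 <= k)%N -> Fk k = limn Fk,
      0 < theta <= 1 / 2 ->
        exists (k0 : nat) (C0hat Q : R),
          [/\ (1 <= k0)%N, 0 < C0hat, 0 <= Q < 1 &
            forall k, (k0 <= k)%N ->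
              (0 <= Fk k - limn Fk <= (C0hat * Q ^+ k)%:E)%E]
    & 1 / 2 < theta < 1 ->
        exists (k0 : nat) (C1hat : R),
          [/\ (3 <= k0)%N, 0 < C1hat &
            forall k, (k0 <= k)%N ->
              (0 <= Fk k - limn Fk
                 <= (C1hat * (k%:R - 1) `^ (- (1 / (2 * theta - 1))))%:E)%E]].
Proof.
rewrite Fk_lim => CL0 th [lojF lojlim].
have [xh [zh [yh d0]]] := iterates_converge lojF.
have [xx zz yy] := dist_to_cvg d0.
have [eps eps0 loj] := lojlim _ _ _ xx zz yy.
have [M M0 [N NP]] := gap_recursion CL0 eps0 d0 loj.
(* [gap] is indexed from the first iterate; [delta] restores the original index. *)
pose delta k := gap k.-1.
have delta0 k : (N.+1 <= k)%N -> 0 <= delta k by move=> _; exact: gap_ge0.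
have delta_to0 : tends_to_0 delta.
  by move=> e /gap_to0[K KP]; exists K.+1 => -[//|k]; exact: KP.
have rec k : (N.+1 <= k)%N -> delta k.+2 != 0 ->
    (delta k.+2 `^ theta) ^+ 2 <= M * (delta k - delta k.+2).
  by case: k => // k; exact: NP.
have FkB k : (0 < k)%N -> (Fk k - merit_lim%:E = (delta k)%:E)%E.
  by case: k => // k _; rewrite FkE.
split=> [th0|th0|th0].
- have [K KP] := finite_rate M0 delta0 delta_to0 rec th0.
  exists K.+1 => // -[//|k] kK; rewrite FkE; congr (_%:E).
  by apply/eqP; rewrite -subr_eq0; apply/eqP/(KP k.+1)/ltnW.
- have [K [C0 [Q [C00 /andP[Q0 Q1] KP]]]] :=
    linear_rate M0 delta0 delta_to0 rec th0.
  exists K.+1, C0, Q; split=> //; first by rewrite (ltW Q0).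
  move=> k kK; rewrite FkB ?(leq_trans _ kK)// !lee_fin gap_ge0 /=.
  by rewrite KP // ltnW.
- have [K [C1 [K3 C10 KP]]] := sublinear_rate M0 delta0 rec th0.
  exists K, C1; split=> // k kK; rewrite FkB; last first.
    by apply: leq_trans kK; exact: leq_trans K3.
  by rewrite !lee_fin gap_ge0 /= KP.
Qed.
End Iteration.

Theorem theorem18 (R : realType) (m n : nat) (alg : algorithm)
    (g : 'cV[R]_m -> \bar R) (h : 'cV[R]_n -> R) (A : 'M[R]_(m, n))
    (L r rho : R) (M1 : nat -> 'M[R]_n) (M2 : nat -> 'M[R]_m)
    (x : nat -> 'cV[R]_n) (z y : nat -> 'cV[R]_m) (CL theta : R) :
  proper_fun g ->
  lower_semicontinuous g ->
  (forall v : 'cV[R]_n, differentiable h v) ->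
  (forall v v' : 'cV[R]_n,
     enorm (gradient h v - gradient h v') <= L * enorm (v - v')) ->
  (forall k, (M1 k)^T = M1 k /\ mx_succeq (M1 k) 0) ->
  (forall k, (M2 k)^T = M2 k /\ mx_succeq (M2 k) 0) ->
  0 < r ->
  0 < rho < 2 ->
  assumptionA' alg g h A L r rho M1 M2 ->
  generated_by alg g h A r rho M1 M2 x z y ->
  (exists B : R, forall k,
     [/\ enorm (x k) <= B, enorm (z k) <= B & enorm (y k) <= B]) ->
  let F := reg_aug_lagrangian alg g h A L r rho (sup_opnorm M1) in
  let Fk := fun k : nat => F (x k) (z k) (y k) (x k.-1) (y k.-1) in
  let Fstar := limn Fk in
  0 < CL ->
  0 <= theta < 1 ->
  lojasiewicz_with (on_stack F) Fstar x z y CL theta ->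
  [/\ theta = 0 ->
        exists2 k0 : nat, (1 <= k0)%N &
          forall k, (k0 <= k)%N -> Fk k = Fstar,
      0 < theta <= 1 / 2 ->
        exists (k0 : nat) (C0hat Q : R),
          [/\ (1 <= k0)%N, 0 < C0hat, 0 <= Q < 1 &
            forall k, (k0 <= k)%N ->
              (0 <= Fk k - Fstar <= (C0hat * Q ^+ k)%:E)%E]
    & 1 / 2 < theta < 1 ->
        exists (k0 : nat) (C1hat : R),
          [/\ (3 <= k0)%N, 0 < C1hat &
            forall k, (k0 <= k)%N ->
              (0 <= Fk k - Fstar
                 <= (C1hat * (k%:R - 1) `^ (- (1 / (2 * theta - 1))))%:E)%E]].
Proof.
move=> g_proper g_lsc h_diff h_lip M1_psd M2_psd r_gt0 rho_itv assm gen bounded.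
move=> F Fk Fstar CL0 th loj.
exact: (convergence_rates g_proper g_lsc h_diff h_lip M1_psd M2_psd r_gt0
  rho_itv assm gen bounded CL0 th loj).
Qed.
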